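(* Let $m\geq 2$ be an integer, $\mathbf{p}=(p_1,\ldots,p_m)\in[1,\infty]^m$ with $\left|\frac{1}{\mathbf{p}}\right|\leq\frac12$, and $\mathbf{r}=(r_1,\ldots,r_m)\in[1,2]^m$. Then there is a constant $D^{\mathbb{K}}_{m,\mathbf{r},\mathbf{p}}\geq 1$ (not depending on $n$) such that $$\left(\sum_{i_1=1}^n\left(\cdots\left(\sum_{i_m=1}^n|T(e_{i_1},\ldots,e_{i_m})|^{r_m}\right)^{\frac{r_{m-1}}{r_m}}\cdots\right)^{\frac{r_1}{r_2}}\right)^{\frac{1}{r_1}}\leq D^{\mathbb{K}}_{m,\mathbf{r},\mathbf{p}}\, n^{\max\left\{\left|\frac{1}{\mathbf{r}}\right|-\frac{m+1}{2}+\left|\frac{1}{\mathbf{p}}\right|,\,0\right\}}\,\|T\|$$ for all positive integers $n$ and all $m$-linear forms $T:\ell_{p_1}^n\times\cdots\times\ell_{p_m}^n\to\mathbb{K}$. Moreover, the exponent $\max\left\{\left|\frac{1}{\mathbf{r}}\right|-\frac{m+1}{2}+\left|\frac{1}{\mathbf{p}}\right|,0\right\}$ is optimal, i.e. it cannot be replaced by any smaller exponent, whatever the constant.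
   Context: $\mathbb{K}=\mathbb{R}$ or $\mathbb{C}$. For a positive integer $n$ and $p\in[1,\infty]$, $\ell_p^n$ is $\mathbb{K}^n$ with the $\ell_p$-norm (sup norm if $p=\infty$); $e_j$ denotes the $j$-th canonical unit vector. For a tuple $\mathbf{q}=(q_1,\ldots,q_m)$ of positive extended reals, $\left|\frac{1}{\mathbf{q}}\right|:=\frac{1}{q_1}+\cdots+\frac{1}{q_m}$ (with $1/\infty=0$). $\|T\|=\sup\{|T(x^{(1)},\ldots,x^{(m)})|:\|x^{(j)}\|_{p_j}\le 1\}$. *)

(* Defs.v *)
From Stdlib Require Import Reals Lra Lia.
Open Scope R_scope.

Inductive field_kind := Kreal | Kcomplex.

Definition Cx : Type := (R * R)%type.
Definition C0 : Cx := (0, 0).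
Definition C1 : Cx := (1, 0).
Definition Cadd (z w : Cx) : Cx := (fst z + fst w, snd z + snd w).
Definition Cmul (z w : Cx) : Cx :=
  (fst z * fst w - snd z * snd w, fst z * snd w + snd z * fst w).
Definition Cabs (z : Cx) : R := sqrt (fst z * fst z + snd z * snd z).

Definition inK (K : field_kind) (z : Cx) : Prop :=
  match K with Kreal => snd z = 0 | Kcomplex => True end.

Fixpoint fsum (n : nat) (f : nat -> R) : R :=
  match n with O => 0 | S k => fsum k f + f k end.
Fixpoint fmax (n : nat) (f : nat -> R) : R :=
  match n with O => 0 | S k => Rmax (fmax k f) (f k) end.

(* x^y for x >= 0 and y > 0 (with 0^y = 0) *)
Definition rpow (x y : R) : R :=
  if Req_EM_T x 0 then 0 else Rpower x y.

Inductive ext := Fin (q : R) | Inf.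
Definition ext_ge1 (q : ext) : Prop :=
  match q with Fin a => 1 <= a | Inf => True end.
Definition ext_inv (q : ext) : R :=
  match q with Fin a => / a | Inf => 0 end.
Definition sum_inv (m : nat) (q : nat -> ext) : R := fsum m (fun j => ext_inv (q j)).

(* ---------- vectors of K^n: nat -> Cx, coordinates i < n ---------- *)
Definition lp_norm (q : ext) (n : nat) (v : nat -> Cx) : R :=
  match q with
  | Fin a => rpow (fsum n (fun i => rpow (Cabs (v i)) a)) (/ a)
  | Inf => fmax n (fun i => Cabs (v i))
  end.

Definition unitv (i : nat) : nat -> Cx := fun l => if Nat.eqb l i then C1 else C0.

(* an m-tuple of vectors: x j is the j-th vector (j < m) *)
Definition upd {A} (x : nat -> A) (k : nat) (a : A) : nat -> A :=
  fun j => if Nat.eqb j k then a else x j.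

Definition admissible (K : field_kind) (m n : nat) (x : nat -> nat -> Cx) : Prop :=
  forall j i, (j < m)%nat -> (i < n)%nat -> inK K (x j i).

Definition is_multilinear (K : field_kind) (m n : nat)
  (T : (nat -> nat -> Cx) -> Cx) : Prop :=
  (forall x y, (forall j i, (j < m)%nat -> (i < n)%nat -> x j i = y j i) -> T x = T y) /\
  (forall x, admissible K m n x -> inK K (T x)) /\
  (forall x k (a : Cx) (u v : nat -> Cx), (k < m)%nat -> admissible K m n x -> inK K a ->
     (forall i, (i < n)%nat -> inK K (u i)) -> (forall i, (i < n)%nat -> inK K (v i)) ->
     T (upd x k (fun i => Cadd (Cmul a (u i)) (v i)))
     = Cadd (Cmul a (T (upd x k u))) (T (upd x k v))).

(* the set { |T(x^(1),...,x^(m))| : ||x^(j)||_{p_j} <= 1 }; ||T|| is its lub *)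
Definition norm_set (K : field_kind) (m n : nat) (p : nat -> ext)
  (T : (nat -> nat -> Cx) -> Cx) (t : R) : Prop :=
  exists x, admissible K m n x /\
    (forall j, (j < m)%nat -> lp_norm (p j) n (x j) <= 1) /\ t = Cabs (T x).

Definition coefabs (T : (nat -> nat -> Cx) -> Cx) (idx : nat -> nat) : R :=
  Cabs (T (fun j => unitv (idx j))).

(* Nested sums, 0-indexed (r_1..r_m of the paper are r 0 .. r (m-1)).
   mixed_aux d idx handles slot k = m-1-d:
     d = 0   : sum_{i<n} |T(...)|^{r_(m-1)}
     d = S d': sum_{i<n} (mixed_aux d' ...)^{r_k / r_(k+1)} *)
Fixpoint mixed_aux (m n : nat) (r : nat -> R) (T : (nat -> nat -> Cx) -> Cx)
  (d : nat) (idx : nat -> nat) : R :=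
  match d with
  | O => fsum n (fun i => rpow (coefabs T (upd idx (m - 1)%nat i)) (r (m - 1)%nat))
  | S d' => let k := (m - 1 - S d')%nat in
      fsum n (fun i => rpow (mixed_aux m n r T d' (upd idx k i)) (r k / r (S k)))
  end.

Definition mixed_sum (m n : nat) (r : nat -> R) (T : (nat -> nat -> Cx) -> Cx) : R :=
  rpow (mixed_aux m n r T (m - 1)%nat (fun _ => O)) (/ r O).

(* Main.v *)
Require Import Defs.
From Stdlib Require Import Reals Lra Lia List Arith Psatz FinFun FunctionalExtensionality.
Import ListNotations.
Open Scope R_scope.

(** Upper bound.  Write U = |1/p|, lambda = 1/(1-U), and M_k(i)^2 for the sum of |T(e_l)|^2 over the
    multi-indices l with l_k = i.  Khinchine's inequality, applied slot by slot, bounds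
    sum_i (sum_{l_k = i} |T(e_l)|^2 prod_j x_j(l_j)^2)^(1/2) by C ||T|| for all weights x_j in the unit
    balls.  Choosing x_j as a power of M_j and using Hölder's inequality gives
    (sum_i M_k(i)^lambda)^(1/lambda) <= C ||T||, which by Minkowski's inequality controls the mixed norm
    with exponent lambda in slot k and 2 elsewhere.  Interpolating between these m mixed norms, and
    comparing l_r with l_q norms in each slot, gives all r in [1,2]^m.

    Optimality.  Since every p_j >= 2, it suffices to find signs a(l) whose form has norm at most
    n^(1/2+o(1)) on Euclidean balls.  An exponential-moment argument gives signs that work for vectors
    with entries in {-1,0,1}; a functional c with |c(v)| <= B |v|_2 on such vectors lies in weak l_2,
    so passing to arbitrary vectors costs only logarithmic factors.  For exponent 0, the form
    prod_j x_j(0) suffices. *)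

(** * Powers *)

(** At an endpoint, with lambda in one slot and 2 in the others, the reciprocals of the exponents
    add up to (1 - U) + (m - 1)/2 = (m + 1)/2 - U, so the stated power of n is the excess of |1/r|
    over this value. Interpolation reaches only exponents q with |1/q| = (m + 1)/2 - U, and passing
    from q to r is lossless or costs n^(|1/r| - |1/q|); to avoid a mixture of the two, q is chosen
    so that all slots compare in the same direction. The obstacle in the upper bound is that the
    marginals of the different slots are entangled. The weights are therefore built from all
    marginals at once, and the inequality obtained has the unknown sum on both sides. For
    optimality, signs give the mixed norm n^(|1/r|), while Hölder's inequality turns n^(1/2) on
    Euclidean balls into n^(1/2 + m/2 - U) on the balls of the l_(p_j): the same (m + 1)/2 - U. The
    o(1) is harmless, since only strictly smaller exponents have to be excluded. The signs are real
    and the forms are estimated on complex vectors, so one construction serves both scalar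
    fields. *)

Lemma Rdiv_nonneg a b : 0 <= a -> 0 < b -> 0 <= a / b.
Proof. intros; apply Rmult_le_pos; [lra|left; now apply Rinv_0_lt_compat]. Qed.

Lemma rpow_zero y : rpow 0 y = 0.
Proof. unfold rpow; destruct (Req_EM_T 0 0); lra. Qed.

Lemma rpow_Rpower x y : 0 < x -> rpow x y = Rpower x y.
Proof. intros; unfold rpow; destruct (Req_EM_T x 0); lra. Qed.

Lemma Rpower_pos x y : 0 < Rpower x y.
Proof. apply exp_pos. Qed.

Lemma rpow_pos x y : 0 < x -> 0 < rpow x y.
Proof. intros; rewrite rpow_Rpower by lra; apply Rpower_pos. Qed.

Lemma rpow_nonneg x y : 0 <= rpow x y.
Proof. unfold rpow; destruct (Req_EM_T x 0); [lra|left; apply Rpower_pos]. Qed.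

Lemma rpow_plus x a b : 0 <= x -> rpow x (a + b) = rpow x a * rpow x b.
Proof.
  intros [h|<-]; [rewrite !rpow_Rpower by lra; apply Rpower_plus | rewrite !rpow_zero; ring].
Qed.

Lemma rpow_rpow x a b : 0 <= x -> rpow (rpow x a) b = rpow x (a * b).
Proof.
  intros [h|<-]; [|now rewrite !rpow_zero].
  rewrite (rpow_Rpower x a), (rpow_Rpower x (a*b)) by lra.
  rewrite rpow_Rpower by apply Rpower_pos. apply Rpower_mult.
Qed.

Lemma rpow_mult_distr x y a : 0 <= x -> 0 <= y -> rpow (x * y) a = rpow x a * rpow y a.
Proof.
  intros [hx|<-] [hy|<-]; rewrite ?Rmult_0_l, ?Rmult_0_r, ?rpow_zero; try ring.
  rewrite !rpow_Rpower by nra. symmetry; apply Rpower_mult_distr; lra.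
Qed.

Lemma rpow_1_r x : 0 <= x -> rpow x 1 = x.
Proof.
  intros [h|<-]; [rewrite rpow_Rpower by lra; now apply Rpower_1|apply rpow_zero].
Qed.

(** Positivity matters here because [rpow 0 0 = 0]; this convention is one reason why later proofs
    split on vanishing sums or coefficients. *)
Lemma rpow_0_r x : 0 < x -> rpow x 0 = 1.
Proof. intros; rewrite rpow_Rpower by lra; now apply Rpower_O. Qed.

Lemma rpow_1_l a : rpow 1 a = 1.
Proof. rewrite rpow_Rpower by lra. unfold Rpower. rewrite ln_1, Rmult_0_r. apply exp_0. Qed.

Lemma rpow_le x y a : 0 <= x <= y -> 0 <= a -> rpow x a <= rpow y a.
Proof.
  intros [[h|<-] hy] ha; [|rewrite rpow_zero; apply rpow_nonneg].
  rewrite !rpow_Rpower by lra. apply Rle_Rpower_l; lra.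
Qed.

Lemma rpow_2_r x : 0 <= x -> rpow x 2 = x * x.
Proof.
  intros hx. replace 2 with (1 + 1) by ring. rewrite rpow_plus by lra. now rewrite rpow_1_r.
Qed.

Lemma rpow_sqrt x : 0 <= x -> rpow x (/ 2) = sqrt x.
Proof.
  intros [h|<-]; [|rewrite rpow_zero; now rewrite sqrt_0].
  rewrite rpow_Rpower by lra. now apply Rpower_sqrt.
Qed.

Lemma rpow_inv_cancel x a : 0 <= x -> a <> 0 -> rpow (rpow x a) (/ a) = x.
Proof.
  intros; rewrite rpow_rpow by lra. rewrite Rinv_r by lra. now apply rpow_1_r.
Qed.

Lemma rpow_inv_cancel' x a : 0 <= x -> a <> 0 -> rpow (rpow x (/ a)) a = x.
Proof.
  intros; rewrite rpow_rpow by lra. rewrite Rinv_l by lra. now apply rpow_1_r.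
Qed.

Lemma rpow_le_inv x y a : 0 <= x -> 0 <= y -> 0 < a -> rpow x a <= rpow y a -> x <= y.
Proof.
  intros hx hy ha h. rewrite <- (rpow_inv_cancel x a), <- (rpow_inv_cancel y a) by lra.
  apply rpow_le; [split; [apply rpow_nonneg|auto]|left; now apply Rinv_0_lt_compat].
Qed.

Lemma rpow_le_1 x a : 0 <= x <= 1 -> 0 <= a -> rpow x a <= 1.
Proof. intros; rewrite <- (rpow_1_l a); apply rpow_le; lra. Qed.

Lemma rpow_monotone x a b : 1 <= x -> a <= b -> rpow x a <= rpow x b.
Proof.
  intros hx hab. rewrite !rpow_Rpower by lra. apply Rle_Rpower; lra.
Qed.

(** * Finite sums and products over lists *)

(** Lists serve as index sets because the sums run over intervals, multi-indices, supports and codes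
    of test vectors alike. *)
Fixpoint lsum {A} (L : list A) (f : A -> R) : R :=
  match L with nil => 0 | x :: L' => f x + lsum L' f end.
Fixpoint lprod {A} (L : list A) (f : A -> R) : R :=
  match L with nil => 1 | x :: L' => f x * lprod L' f end.

Section Sums.
Context {A : Type}.
Implicit Types (L : list A) (f g : A -> R).

Lemma lsum_ext L f g : (forall x, In x L -> f x = g x) -> lsum L f = lsum L g.
Proof. induction L; simpl; intros h; [auto|rewrite h, IHL; auto]. Qed.

Lemma lprod_ext L f g : (forall x, In x L -> f x = g x) -> lprod L f = lprod L g.
Proof. induction L; simpl; intros h; [auto|rewrite h, IHL; auto]. Qed.

Lemma lsum_plus L f g : lsum L (fun x => f x + g x) = lsum L f + lsum L g.
Proof. induction L; simpl; lra. Qed.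

Lemma lsum_scal L c f : lsum L (fun x => c * f x) = c * lsum L f.
Proof. induction L; simpl; lra. Qed.

Lemma lsum_scal_r L c f : lsum L (fun x => f x * c) = lsum L f * c.
Proof. induction L; simpl; lra. Qed.

Lemma lsum_le L f g : (forall x, In x L -> f x <= g x) -> lsum L f <= lsum L g.
Proof.
  induction L; simpl; intros h; [lra|].
  apply Rplus_le_compat; [apply h|apply IHL; intros; apply h]; auto.
Qed.

Lemma lsum_nonneg L f : (forall x, In x L -> 0 <= f x) -> 0 <= lsum L f.
Proof.
  induction L; simpl; intros h; [lra|].
  apply Rplus_le_le_0_compat; [apply h|apply IHL; intros; apply h]; auto.
Qed.

Lemma lsum_const L c : lsum L (fun _ => c) = INR (length L) * c.
Proof. induction L; [simpl; lra|]. cbn [lsum length]. rewrite S_INR, IHL. ring. Qed.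

Lemma lsum_app L L' f : lsum (L ++ L') f = lsum L f + lsum L' f.
Proof. induction L; simpl; lra. Qed.

Lemma lsum_term_le L f x : (forall y, In y L -> 0 <= f y) -> In x L -> f x <= lsum L f.
Proof.
  induction L as [|y L IH]; simpl; [tauto|]; intros h [->|hx].
  - assert (0 <= lsum L f) by (apply lsum_nonneg; auto). lra.
  - assert (f x <= lsum L f) by (apply IH; auto). assert (0 <= f y) by auto. lra.
Qed.

Lemma lsum_zero_term L f x :
  (forall y, In y L -> 0 <= f y) -> lsum L f = 0 -> In x L -> f x = 0.
Proof.
  intros h h0 hx. assert (h1 := lsum_term_le L f x h hx). assert (0 <= f x) by auto. lra.
Qed.

Lemma lprod_nonneg L f : (forall x, In x L -> 0 <= f x) -> 0 <= lprod L f.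
Proof.
  induction L; simpl; intros h; [lra|]. apply Rmult_le_pos; auto.
Qed.

Lemma lprod_pos L f : (forall x, In x L -> 0 < f x) -> 0 < lprod L f.
Proof.
  induction L; simpl; intros h; [lra|]. apply Rmult_lt_0_compat; auto.
Qed.

Lemma lprod_le L f g : (forall x, In x L -> 0 <= f x <= g x) -> lprod L f <= lprod L g.
Proof.
  induction L; simpl; intros h; [lra|].
  apply Rmult_le_compat; try (apply h; auto); auto.
  apply lprod_nonneg; intros; apply h; auto.
Qed.

Lemma lprod_mult L f g : lprod L (fun x => f x * g x) = lprod L f * lprod L g.
Proof. induction L; simpl; [ring|rewrite IHL; ring]. Qed.

Lemma lprod_zero L f x : In x L -> f x = 0 -> lprod L f = 0.
Proof.
  induction L; simpl; [tauto|intros [->|h] h0]; [rewrite h0; ring|rewrite IHL; auto; ring].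
Qed.

Lemma lprod_rpow L f a : (forall x, In x L -> 0 <= f x) ->
  rpow (lprod L f) a = lprod L (fun x => rpow (f x) a).
Proof.
  induction L; simpl; intros h; [apply rpow_1_l|].
  rewrite rpow_mult_distr, IHL; auto. apply lprod_nonneg; auto.
Qed.

Lemma lprod_rpow_const L x w : 0 < x ->
  lprod L (fun j => rpow x (w j)) = rpow x (lsum L w).
Proof.
  intros hx; induction L; simpl; [now rewrite rpow_0_r|rewrite rpow_plus, IHL; lra].
Qed.

Lemma exists_pos_or_all_zero L f : (forall x, In x L -> 0 <= f x) ->
  (forall x, In x L -> 0 < f x) \/ exists x, In x L /\ f x = 0.
Proof.
  induction L as [|y L IH]; simpl; intros h; [left; tauto|].
  destruct IH as [IH|(x & hx & h0)]; auto.
  - destruct (h y) as [hy|hy]; auto; [left; intros x [<-|hx]; auto|right; exists y; auto].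
  - right; exists x; auto.
Qed.

Lemma list_argmax L f : L <> nil -> exists x, In x L /\ forall y, In y L -> f y <= f x.
Proof.
  induction L as [|a L IH]; [tauto|intros _].
  destruct L as [|b L]; [exists a; simpl; split; auto; intros y [->|[]]; lra|].
  destruct IH as (x & hx & hm); [discriminate|].
  destruct (Rle_dec (f a) (f x)) as [h|h].
  - exists x; split; [right; auto|]. intros y [<-|hy]; auto.
  - exists a; split; [left; auto|]. intros y [<-|hy]; [lra|]. specialize (hm y hy). lra.
Qed.

End Sums.

Lemma lsum_swap {A B} (L : list A) (L' : list B) (f : A -> B -> R) :
  lsum L (fun x => lsum L' (f x)) = lsum L' (fun y => lsum L (fun x => f x y)).
Proof.
  induction L; simpl; [rewrite lsum_const; ring|].
  rewrite IHL, <- lsum_plus. reflexivity.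
Qed.

Lemma lsum_map {A B} (L : list A) (h : A -> B) (f : B -> R) :
  lsum (map h L) f = lsum L (fun x => f (h x)).
Proof. induction L; simpl; congruence. Qed.

Lemma lsum_flat_map {A B} (L : list A) (h : A -> list B) (f : B -> R) :
  lsum (flat_map h L) f = lsum L (fun x => lsum (h x) f).
Proof. induction L; simpl; [auto|]. rewrite lsum_app. congruence. Qed.

Lemma fsum_lsum n f : fsum n f = lsum (seq 0 n) f.
Proof.
  induction n; [reflexivity|]. rewrite seq_S, lsum_app. simpl. rewrite IHn. ring.
Qed.

Lemma lsum_seq_shift n f : lsum (seq 0 (S n)) f = f O + lsum (seq 0 n) (fun i => f (S i)).
Proof. simpl. rewrite <- seq_shift, lsum_map. reflexivity. Qed.

Lemma lsum_seq_S n f : lsum (seq 0 (S n)) f = lsum (seq 0 n) f + f n.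
Proof. rewrite seq_S, lsum_app; simpl; ring. Qed.

Lemma lsum_seq_single n k f : (k < n)%nat ->
  lsum (seq 0 n) (fun i => if Nat.eqb i k then f i else 0) = f k.
Proof.
  induction n; [lia|intros h]. rewrite lsum_seq_S.
  destruct (Nat.eqb_spec n k) as [->|hk].
  - rewrite (lsum_ext _ _ (fun _ => 0)), lsum_const; [ring|].
    intros i hi%in_seq. destruct (Nat.eqb_spec i k); [lia|auto].
  - rewrite IHn by lia. ring.
Qed.

(** * Hölder and Minkowski inequalities *)

(** With mu the weighted mean of the ln x_j, the tangent of exp at mu gives x_j >= exp(mu) (1 + ln
    x_j - mu), and the weighted sum of the right-hand sides is exp(mu), the geometric mean. *)
Lemma weighted_amgm {A} (J : list A) (x w : A -> R) :
  (forall j, In j J -> 0 <= x j) -> (forall j, In j J -> 0 <= w j) -> lsum J w = 1 ->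
  lprod J (fun j => rpow (x j) (w j)) <= lsum J (fun j => w j * x j).
Proof.
  intros hx hw hs.
  destruct (exists_pos_or_all_zero J x hx) as [hp|(j & hj & h0)].
  2:{ rewrite (lprod_zero J _ j hj) by (rewrite h0; apply rpow_zero).
      apply lsum_nonneg; intros; apply Rmult_le_pos; auto. }
  set (mu := lsum J (fun j => w j * ln (x j))).
  assert (hE : lprod J (fun j => rpow (x j) (w j)) = exp mu).
  { unfold mu; clear -hp. induction J as [|a J IH]; simpl in *; [now rewrite exp_0|].
    rewrite exp_plus, IH, rpow_Rpower; auto. }
  rewrite hE.
  replace (exp mu) with (lsum J (fun j => w j * (exp mu * (1 + ln (x j) - mu)))).
  - apply lsum_le; intros j hj. apply Rmult_le_compat_l; auto.
    rewrite <- (exp_ln (x j)) at 2 by auto.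
    replace (exp (ln (x j))) with (exp mu * exp (ln (x j) - mu)) by (rewrite <- exp_plus; f_equal; ring).
    apply Rmult_le_compat_l; [left; apply exp_pos|].
    assert (h := exp_ineq1_le (ln (x j) - mu)). lra.
  - rewrite (lsum_ext _ _ (fun j => exp mu * (1 - mu) * w j + exp mu * (w j * ln (x j)))) by (intros; ring).
    rewrite lsum_plus, !lsum_scal, hs. fold mu. ring.
Qed.

(** Dividing each [f j] by its sum reduces the claim to the weighted arithmetic-geometric inequality
    at every index. Both the marginals and the mixed norms need the version with m functions and
    weights adding up to 1. *)
Lemma holder {A B} (L : list A) (J : list B) (f : B -> A -> R) (w : B -> R) :
  (forall j i, In j J -> In i L -> 0 <= f j i) -> (forall j, In j J -> 0 <= w j) -> lsum J w = 1 ->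
  lsum L (fun i => lprod J (fun j => rpow (f j i) (w j)))
  <= lprod J (fun j => rpow (lsum L (f j)) (w j)).
Proof.
  intros hf hw hs.
  assert (hS : forall j, In j J -> 0 <= lsum L (f j)) by (intros; apply lsum_nonneg; auto).
  destruct (exists_pos_or_all_zero J (fun j => lsum L (f j)) hS) as [hp|(j & hj & h0)].
  2:{ rewrite (lsum_ext _ _ (fun _ => 0)).
      - rewrite lsum_const, Rmult_0_r. apply lprod_nonneg; intros; apply rpow_nonneg.
      - intros i hi. apply lprod_zero with j; auto.
        rewrite (lsum_zero_term L (f j) i); auto. apply rpow_zero. }
  set (S := fun j => lsum L (f j)) in *.
  change (forall j, In j J -> 0 < S j) in hp.
  set (P := lprod J (fun j => rpow (S j) (w j))).
  assert (hP : 0 <= P) by (apply lprod_nonneg; intros; apply rpow_nonneg).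
  apply Rle_trans with (lsum L (fun i => P * lsum J (fun j => w j * (f j i / S j)))).
  - apply lsum_le; intros i hi.
    rewrite (lprod_ext _ _ (fun j => rpow (S j) (w j) * rpow (f j i / S j) (w j))).
    + rewrite lprod_mult. apply Rmult_le_compat_l; auto.
      apply weighted_amgm; auto. intros j hj. apply Rdiv_nonneg; auto.
    + intros j hj. specialize (hp j hj).
      rewrite <- rpow_mult_distr; [|lra|apply Rdiv_nonneg; auto].
      f_equal; field; lra.
  - rewrite lsum_scal, lsum_swap.
    rewrite (lsum_ext _ _ w); [rewrite hs; fold P; change (P * 1 <= P); lra|].
    intros j hj. specialize (hp j hj). rewrite lsum_scal. unfold Rdiv. rewrite lsum_scal_r. fold (S j). field; lra.
Qed.

Lemma holder2 {A} (L : list A) (f g : A -> R) (t : R) :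
  (forall i, In i L -> 0 <= f i) -> (forall i, In i L -> 0 <= g i) -> 0 <= t <= 1 ->
  lsum L (fun i => rpow (f i) t * rpow (g i) (1 - t))
  <= rpow (lsum L f) t * rpow (lsum L g) (1 - t).
Proof.
  intros hf hg ht.
  assert (h := holder L [true; false] (fun b : bool => if b then f else g)
                 (fun b : bool => if b then t else 1 - t)).
  simpl in h. rewrite Rmult_1_r in h.
  rewrite (lsum_ext _ _ (fun i => rpow (f i) t * (rpow (g i) (1 - t) * 1))) by (intros; ring).
  apply h; [|intros j _; destruct j; lra|lra].
  intros [] i _ hi; auto.
Qed.

(** The sum H of h^s is written as a double sum of g h^(s-1). Hölder's inequality in x, for each
    fixed y, gives H <= H^(1 - 1/s) RHS, and H^(1 - 1/s) is divided out. *)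
Lemma minkowski {A B} (L : list A) (L' : list B) (g : A -> B -> R) (s : R) :
  1 <= s -> (forall x y, In x L -> In y L' -> 0 <= g x y) ->
  rpow (lsum L (fun x => rpow (lsum L' (g x)) s)) (/ s)
  <= lsum L' (fun y => rpow (lsum L (fun x => rpow (g x y) s)) (/ s)).
Proof.
  intros hs hg.
  set (h := fun x => lsum L' (g x)).
  assert (hh : forall x, In x L -> 0 <= h x) by (intros; apply lsum_nonneg; auto).
  set (H := lsum L (fun x => rpow (h x) s)).
  assert (hH : 0 <= H) by (apply lsum_nonneg; intros; apply rpow_nonneg).
  set (RHS := lsum L' _). change (rpow H (/ s) <= RHS).
  assert (hR : 0 <= RHS) by (apply lsum_nonneg; intros; apply rpow_nonneg).
  assert (hinv : 0 < / s <= 1).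
  { split; [apply Rinv_0_lt_compat; lra|]. rewrite <- Rinv_1. apply Rinv_le_contravar; lra. }
  assert (key : H <= rpow H (1 - / s) * RHS).
  { unfold H at 1. rewrite (lsum_ext _ _ (fun x => lsum L' (fun y => g x y * rpow (h x) (s - 1)))).
    - rewrite lsum_swap. unfold RHS. rewrite <- lsum_scal. apply lsum_le; intros y hy.
      rewrite (lsum_ext _ _ (fun x => rpow (rpow (g x y) s) (/ s) * rpow (rpow (h x) s) (1 - / s))).
      + eapply Rle_trans; [apply holder2|]; try lra; try (intros; apply rpow_nonneg).
        unfold H. lra.
      + intros x hx. rewrite rpow_inv_cancel by (auto; lra). rewrite rpow_rpow by auto.
        f_equal. f_equal. field; lra.
    - intros x hx. rewrite lsum_scal_r. fold (h x).
      replace s with (1 + (s - 1)) at 1 by ring. rewrite rpow_plus, rpow_1_r; auto. }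
  destruct hH as [hH|hH]; [|rewrite <- hH, rpow_zero; auto].
  assert (hp := rpow_pos H (1 - / s) hH).
  apply Rmult_le_reg_l with (rpow H (1 - / s)); auto.
  rewrite <- rpow_plus by lra. replace (1 - / s + / s) with 1 by ring. rewrite rpow_1_r; lra.
Qed.

Lemma cauchy_schwarz {A} (L : list A) (f g : A -> R) :
  (lsum L (fun i => f i * g i)) ^ 2 <= lsum L (fun i => f i * f i) * lsum L (fun i => g i * g i).
Proof.
  set (F := lsum L (fun i => f i * f i)). set (G := lsum L (fun i => g i * g i)).
  set (P := lsum L _).
  assert (hq : forall a b, 0 <= a * a * F + 2 * a * b * P + b * b * G).
  { intros a b.
    replace (a * a * F + 2 * a * b * P + b * b * G)
      with (lsum L (fun i => (a * f i + b * g i) * (a * f i + b * g i))).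
    - apply lsum_nonneg; intros; apply Rle_0_sqr.
    - unfold F, G, P. rewrite <- !lsum_scal, <- !lsum_plus. apply lsum_ext; intros; ring. }
  assert (hF : 0 <= F) by (apply lsum_nonneg; intros; apply Rle_0_sqr).
  (* These two choices yield F (F G - P^2) and G (F G - P^2). If F = G = 0, the values at (1, 1) and
     (1, -1) force P = 0. *)
  assert (h1 := hq P (- F)). assert (h2 := hq G (- P)).
  assert (hG : 0 <= G) by (apply lsum_nonneg; intros; apply Rle_0_sqr).
  destruct hF as [hF|hF]; [assert (0 <= F * (F * G - P * P)) by nra; nra|].
  destruct hG as [hG|hG]; [assert (0 <= G * (F * G - P * P)) by nra; nra|].
  rewrite <- hF, <- hG in hq. assert (h3 := hq 1 1). assert (h4 := hq 1 (-1)). nra.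
Qed.

(** * Bounds on marginals of an array from weighted bounds *)

Definition crd (l : list nat) (j : nat) : nat := nth j l O.

(** The marginal of F in slot k at the value i. An indicator instead of a filtered list lets the
    sums over i and over l be interchanged directly. *)
Definition fib (L : list (list nat)) (k i : nat) (F : list nat -> R) : R :=
  lsum L (fun l => if Nat.eqb (crd l k) i then F l else 0).

Lemma fib_ext L k i F G : (forall l, In l L -> crd l k = i -> F l = G l) -> fib L k i F = fib L k i G.
Proof.
  intros h; apply lsum_ext; intros l hl. destruct (Nat.eqb_spec (crd l k) i); auto.
Qed.

Lemma fib_nonneg L k i F : (forall l, In l L -> 0 <= F l) -> 0 <= fib L k i F.
Proof.
  intros h; apply lsum_nonneg; intros l hl. destruct (Nat.eqb (crd l k) i); auto; lra.
Qed.

Lemma fib_scal_r L k i F c : fib L k i (fun l => F l * c) = fib L k i F * c.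
Proof.
  unfold fib. rewrite <- lsum_scal_r. apply lsum_ext; intros.
  destruct (Nat.eqb (crd x k) i); ring.
Qed.

Lemma fib_pos L l k F : (forall l, In l L -> 0 <= F l) -> In l L -> 0 < F l -> 0 < fib L k (crd l k) F.
Proof.
  intros h hl hp. apply Rlt_le_trans with (F l); auto.
  assert (h1 := lsum_term_le L (fun l' => if Nat.eqb (crd l' k) (crd l k) then F l' else 0) l).
  simpl in h1. rewrite Nat.eqb_refl in h1. apply h1; auto.
  intros y hy. destruct (Nat.eqb (crd y k) (crd l k)); auto; lra.
Qed.

Lemma lsum_fib n L k g F : (forall l, In l L -> (crd l k < n)%nat) ->
  lsum (seq 0 n) (fun i => g i * fib L k i F) = lsum L (fun l => g (crd l k) * F l).
Proof.
  intros hL. unfold fib.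
  rewrite (lsum_ext _ _ (fun i => lsum L (fun l => if Nat.eqb i (crd l k) then g i * F l else 0))).
  - rewrite lsum_swap. apply lsum_ext; intros l hl.
    now rewrite (lsum_seq_single n (crd l k) (fun i => g i * F l)) by auto.
  - intros i _. rewrite <- lsum_scal. apply lsum_ext; intros l _.
    rewrite (Nat.eqb_sym i). destruct (Nat.eqb (crd l k) i); ring.
Qed.

(* The unit ball of l_{1/u}^n intersected with the nonnegative weights; u = 0 encodes the sup norm. *)
Definition in_ball (u : R) (n : nat) (x : nat -> R) : Prop :=
  if Req_EM_T u 0 then forall i, (i < n)%nat -> x i <= 1
  else lsum (seq 0 n) (fun i => rpow (x i) (/ u)) <= 1.

(** [A l] stands for |T(e_l)|^2. The weights enter squared because putting x_j(l_j) e_(l_j) in the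
    slots multiplies |T(e_l)| by the product of the weights. *)
Definition weighted_bound (m n : nat) (L : list (list nat)) (A : list nat -> R) (u : nat -> R) (C : R) :=
  forall x : nat -> nat -> R,
    (forall j i, 0 <= x j i) -> (forall j, (j < m)%nat -> in_ball (u j) n (x j)) ->
    forall k, (k < m)%nat ->
      lsum (seq 0 n) (fun i => rpow (fib L k i (fun l =>
         A l * lprod (seq 0 m) (fun j => rpow (x j (crd l j)) 2))) (/ 2)) <= C.

Lemma lprod_single m k z : (k < m)%nat ->
  lprod (seq 0 m) (fun j => if Nat.eqb j k then z else 1) = z.
Proof.
  intros hk.
  enough (h : forall L, NoDup L ->
    lprod L (fun j => if Nat.eqb j k then z else 1) = if in_dec Nat.eq_dec k L then z else 1).
  { rewrite h by apply seq_NoDup. destruct in_dec as [|n]; auto.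
    destruct n. apply in_seq; lia. }
  clear. induction L as [|a L IH]; intros hnd; [reflexivity|].
  inversion_clear hnd. cbn [lprod]. rewrite IH by auto.
  destruct (Nat.eqb_spec a k) as [->|hak];
    destruct (in_dec Nat.eq_dec k L), in_dec as [h|h]; simpl in h; tauto || ring.
Qed.

Lemma lprod_rpow_single m k (s : nat -> R) d : (k < m)%nat -> (forall j, In j (seq 0 m) -> 0 < s j) ->
  lprod (seq 0 m) (fun j => rpow (s j) (if Nat.eqb j k then d else 0)) = rpow (s k) d.
Proof.
  intros hk hs. rewrite <- (lprod_single m k (rpow (s k) d)) by auto.
  apply lprod_ext; intros j hj. destruct (Nat.eqb_spec j k) as [->|]; auto.
  apply rpow_0_r; auto.
Qed.

Section Marginals.
Variables (m n : nat) (L : list (list nat)) (A : list nat -> R).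
Hypothesis hL : forall l j, In l L -> (j < m)%nat -> (crd l j < n)%nat.
Hypothesis hA : forall l, In l L -> 0 <= A l.

(* The weights x_j(i) = (M_j(i)^lambda / N)^(u_j), with M_j^2 the marginals and N the largest of the
   sums of M_j^lambda, turn the weighted bound into a self-improving inequality N <= (C N^U)^t N^(1-t). *)
Lemma marginal_bound_lt (u : nat -> R) (U C : R) :
  (forall j, (j < m)%nat -> 0 <= u j) -> lsum (seq 0 m) u = U -> U < / 2 -> 0 <= C ->
  weighted_bound m n L A u C ->
  forall k, (k < m)%nat ->
    lsum (seq 0 n) (fun i => rpow (fib L k i A) (/ (1 - U) / 2)) <= rpow C (/ (1 - U)).
Proof.
  intros hu hU hU2 hC hw k0 hk0.
  assert (hU0 : 0 <= U) by (rewrite <- hU; apply lsum_nonneg; intros j hj%in_seq; apply hu; lia).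
  set (la := / (1 - U)).
  assert (hla : la * (1 - U) = 1) by (unfold la; field; lra).
  assert (hla1 : 1 <= la < 2) by (split; nra).
  set (S := fun k i => fib L k i A).
  assert (hS : forall k i, 0 <= S k i) by (intros; apply fib_nonneg; auto).
  set (Nk := fun k => lsum (seq 0 n) (fun i => rpow (S k i) (la / 2))).
  destruct (list_argmax (seq 0 m) Nk) as (k & hk & hmax); [destruct m; [lia|discriminate]|].
  apply Rle_trans with (Nk k); [apply hmax; apply in_seq; lia|]. clear k0 hk0.
  set (N := Nk k) in *.
  assert (hN : 0 <= N) by (apply lsum_nonneg; intros; apply rpow_nonneg).
  destruct hN as [hN|hN]; [|rewrite <- hN; apply rpow_nonneg].
  assert (hSpos : forall l j, In l L -> 0 < A l -> 0 < S j (crd l j)) by (intros; apply fib_pos; auto).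
  (* The l_(1/u_j) norm of this weight is (N_j / N)^(u_j), at most 1 because N is the largest of the
     sums; for u_j = 0 the weight takes only the values 0 and 1. *)
  pose (x := fun j i => if Nat.ltb j m then rpow (S j i) (la / 2 * u j) * rpow N (- u j) else 0).
  assert (hx0 : forall j i, 0 <= x j i).
  { intros j i; unfold x. destruct (Nat.ltb j m); [|lra].
    apply Rmult_le_pos; apply rpow_nonneg. }
  assert (hxb : forall j, (j < m)%nat -> in_ball (u j) n (x j)).
  { intros j hj. unfold in_ball, x. rewrite (proj2 (Nat.ltb_lt j m) hj).
    specialize (hu j hj). destruct (Req_EM_T (u j) 0) as [->|hu0].
    - intros i _. rewrite Ropp_0, (rpow_0_r N), Rmult_0_r by lra.
      destruct (hS j i) as [h|h]; [rewrite rpow_0_r|rewrite <- h, rpow_zero]; lra.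
    - rewrite (lsum_ext _ _ (fun i => rpow (S j i) (la / 2) * / N)).
      + rewrite lsum_scal_r. fold (Nk j). apply Rmult_le_reg_r with N; auto.
        rewrite Rmult_assoc, Rinv_l, Rmult_1_r, Rmult_1_l by lra.
        apply hmax, in_seq; lia.
      + intros i _. rewrite rpow_mult_distr, !rpow_rpow; try apply rpow_nonneg; auto; try lra.
        f_equal; [f_equal; field; auto|].
        replace (- u j * / u j) with (- (1)) by (field; auto).
        rewrite rpow_Rpower, Rpower_Ropp, Rpower_1; auto. }
  pose (G := fun l => lprod (seq 0 m) (fun j => rpow (S j (crd l j)) (la * u j))).
  assert (hG : forall l, 0 <= G l) by (intros; apply lprod_nonneg; intros; apply rpow_nonneg).
  assert (hGpos : forall l, In l L -> 0 < A l -> 0 < G l)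
    by (intros; apply lprod_pos; intros; apply rpow_pos; auto).
  assert (hGx : forall l, lprod (seq 0 m) (fun j => rpow (x j (crd l j)) 2) = G l * rpow N (- 2 * U)).
  { intros l. unfold G.
    rewrite (lprod_ext _ _ (fun j => rpow (S j (crd l j)) (la * u j) * rpow N (- 2 * u j))).
    - rewrite lprod_mult, (lprod_rpow_const _ _ (fun j => -2 * u j)), lsum_scal, hU; auto.
    - intros j hj%in_seq. unfold x. rewrite (proj2 (Nat.ltb_lt j m)) by lia.
      rewrite rpow_mult_distr, !rpow_rpow; try apply rpow_nonneg; auto; try lra.
      f_equal; f_equal; field. }
  pose (F := fun i => fib L k i (fun l => A l * G l)).
  assert (hF : forall i, 0 <= F i) by (intros; apply fib_nonneg; intros; apply Rmult_le_pos; auto).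
  assert (hW : lsum (seq 0 n) (fun i => rpow (F i) (/ 2)) <= C * rpow N U).
  { assert (hkm : (k < m)%nat) by (apply in_seq in hk; lia).
    specialize (hw x hx0 hxb k hkm).
    rewrite (lsum_ext _ _ (fun i => rpow (F i) (/ 2) * rpow N (- U))) in hw.
    - rewrite lsum_scal_r in hw.
      assert (hp := rpow_pos N U hN).
      apply Rmult_le_compat_r with (r := rpow N U) in hw; [|lra].
      rewrite Rmult_assoc, <- rpow_plus, Rplus_opp_l, rpow_0_r in hw; lra.
    - intros i _.
      rewrite (fib_ext _ _ _ _ (fun l => A l * G l * rpow N (-2 * U)))
        by (intros; rewrite hGx; ring).
      rewrite fib_scal_r. fold (F i).
      rewrite rpow_mult_distr, rpow_rpow; try apply rpow_nonneg; auto; try lra.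
      f_equal; f_equal; field. }
  (* The exponents satisfy four relations: [al + b * (1 - al) = 0], so that [G] cancels between [F]
     and [H]; [al * c = t / 2] and [(1 - al) * c = 1 - t], so that Hölder's inequality produces the
     sums of F^(1/2) and of S^b H; and [b * (1 - t) + c = la / 2], the power of S in N. The strict
     inequality U < 1/2 makes t positive. *)
  pose (t := 1 - la / 2). pose (c := / 2 + la / 4). pose (b := / 2 - / la).
  assert (ht : 0 < t <= / 2) by (unfold t; lra).
  pose (al := t / 2 / c). assert (hc : 0 < c) by (unfold c; lra).
  assert (hal : 0 <= al <= 1).
  { unfold al. split; [apply Rdiv_nonneg; lra|].
    apply Rmult_le_reg_r with c; auto. unfold Rdiv at 1. rewrite Rmult_assoc, Rinv_l; unfold c, t; lra. }
  pose (H := fun i => fib L k i (fun l => A l * rpow (G l) b)).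
  assert (hH : forall i, 0 <= H i)
    by (intros; apply fib_nonneg; intros; apply Rmult_le_pos; auto; apply rpow_nonneg).
  (* A = (A G)^al (A G^b)^(1 - al), followed by Hölder's inequality on the slice. *)
  assert (hSF : forall i, S k i <= rpow (F i) al * rpow (H i) (1 - al)).
  { intros i. unfold F, H, fib.
    eapply Rle_trans; [|apply holder2; auto].
    - apply Req_le. unfold S, fib. apply lsum_ext; intros l hl.
      destruct (Nat.eqb (crd l k) i); [|rewrite !rpow_zero; ring].
      destruct (hA l hl) as [h|h]; [|rewrite <- h, !Rmult_0_l, !rpow_zero; ring].
      assert (hg := hGpos l hl h).
      rewrite !rpow_mult_distr, rpow_rpow; try apply rpow_nonneg; try lra.
      replace (rpow (A l) al * rpow (G l) al * (rpow (A l) (1 - al) * rpow (G l) (b * (1 - al))))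
        with ((rpow (A l) al * rpow (A l) (1 - al)) * (rpow (G l) al * rpow (G l) (b * (1 - al)))) by ring.
      rewrite <- !rpow_plus by lra.
      replace (al + (1 - al)) with 1 by ring.
      replace (al + b * (1 - al)) with 0.
      + rewrite rpow_1_r, rpow_0_r; lra.
      + unfold al, b, c, t. field. lra.
    - intros l hl. destruct (Nat.eqb (crd l k) i); [apply Rmult_le_pos; auto|lra].
    - intros l hl. destruct (Nat.eqb (crd l k) i); [apply Rmult_le_pos; auto; apply rpow_nonneg|lra]. }
  assert (hN1 : N <= rpow (lsum (seq 0 n) (fun i => rpow (F i) (/ 2))) t
                  * rpow (lsum (seq 0 n) (fun i => rpow (S k i) b * H i)) (1 - t)).
  { eapply Rle_trans; [|apply holder2].
    - unfold N, Nk. apply lsum_le; intros i _.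
      destruct (hS k i) as [h|h].
      2:{ rewrite <- h, rpow_zero. apply Rmult_le_pos; apply rpow_nonneg. }
      replace (la / 2) with (b * (1 - t) + c) by (unfold b, t, c; field; lra).
      rewrite rpow_plus by auto.
      apply Rle_trans with (rpow (S k i) (b * (1 - t)) * rpow (rpow (F i) al * rpow (H i) (1 - al)) c).
      + apply Rmult_le_compat_l; [apply rpow_nonneg|]. apply rpow_le; [split; auto|lra].
      + apply Req_le. rewrite !rpow_mult_distr, !rpow_rpow; try apply rpow_nonneg; auto.
        replace (al * c) with (/ 2 * t) by (unfold al; field; lra).
        replace ((1 - al) * c) with (1 - t) by (unfold al, c, t; field; lra). ring.
    - intros; apply rpow_nonneg.
    - intros; apply Rmult_le_pos; auto; apply rpow_nonneg.
    - lra. }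
  assert (hk' : (k < m)%nat) by (apply in_seq in hk; lia).
  assert (hN2 : lsum (seq 0 n) (fun i => rpow (S k i) b * H i) <= N).
  { unfold H. rewrite (lsum_fib n L k (fun i => rpow (S k i) b)) by auto.
    (* These weights add up to U + 1/la = 1. Since la b = la/2 - 1, the factors A S_j^(la/2 - 1)
       raised to them reproduce the summand exactly, and the j-th factor sums to [Nk j]. *)
    pose (th := fun j => u j + (if Nat.eqb j k then / la else 0)).
    assert (hth : lsum (seq 0 m) th = 1).
    { unfold th. rewrite lsum_plus, hU, (lsum_seq_single m k (fun _ => / la)) by auto.
      unfold la. rewrite Rinv_inv. ring. }
    assert (hth0 : forall j, In j (seq 0 m) -> 0 <= th j).
    { intros j hj%in_seq. unfold th. specialize (hu j ltac:(lia)).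
      assert (0 < / la) by (apply Rinv_0_lt_compat; lra).
      destruct (Nat.eqb j k); lra. }
    eapply Rle_trans; [|eapply Rle_trans].
    2:{ apply (holder L (seq 0 m) (fun j l => A l * rpow (S j (crd l j)) (la / 2 - 1)) th); auto.
        intros; apply Rmult_le_pos; auto; apply rpow_nonneg. }
    - apply Req_le, lsum_ext; intros l hl.
      destruct (hA l hl) as [h|h].
      2:{ rewrite <- h. rewrite (lprod_zero _ _ k hk); [ring|]. now rewrite Rmult_0_l, rpow_zero. }
      assert (hs : forall j, 0 < S j (crd l j)) by auto.
      rewrite (lprod_ext _ _ (fun j => rpow (A l) (th j) *
          (rpow (S j (crd l j)) (la * u j * b) * rpow (S j (crd l j)) (if Nat.eqb j k then b else 0)))).
      + rewrite !lprod_mult, lprod_rpow_const, hth, rpow_1_r by lra.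
        rewrite (lprod_rpow_single m k (fun j => S j (crd l j)) b) by auto.
        unfold G. rewrite lprod_rpow by (intros; apply rpow_nonneg).
        rewrite (lprod_ext _ (fun j => rpow (rpow _ _) b) (fun j => rpow (S j (crd l j)) (la * u j * b)))
          by (intros; apply rpow_rpow; auto). ring.
      + intros j _. rewrite rpow_mult_distr, rpow_rpow, <- rpow_plus; auto; try lra.
        2: apply rpow_nonneg.
        f_equal; f_equal. unfold th, b. destruct (Nat.eqb j k); field; lra.
    - apply Rle_trans with (lprod (seq 0 m) (fun j => rpow N (th j))).
      + apply lprod_le; intros j hj. split; [apply rpow_nonneg|].
        apply rpow_le; auto. split.
        * apply lsum_nonneg; intros; apply Rmult_le_pos; auto; apply rpow_nonneg.
        * apply Rle_trans with (Nk j); auto.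
          apply Req_le.
          rewrite (lsum_ext _ _ (fun l => rpow (S j (crd l j)) (la / 2 - 1) * A l)) by (intros; ring).
          rewrite <- (lsum_fib n L j (fun i => rpow (S j i) (la / 2 - 1)) A)
            by (apply in_seq in hj; intros; apply hL; auto; lia).
          apply lsum_ext; intros i _. fold (S j i).
          replace (la / 2) with (la / 2 - 1 + 1) at 2 by ring.
          rewrite rpow_plus, rpow_1_r; auto.
      + rewrite lprod_rpow_const, hth, rpow_1_r; lra. }
  assert (hW0 : 0 <= lsum (seq 0 n) (fun i => rpow (F i) (/ 2)))
    by (apply lsum_nonneg; intros; apply rpow_nonneg).
  assert (hN3 : N <= rpow (C * rpow N U) t * rpow N (1 - t)).
  { eapply Rle_trans; [exact hN1|]. apply Rmult_le_compat; try apply rpow_nonneg.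
    - apply rpow_le; [split; auto|lra].
    - apply rpow_le; [split; auto|lra].
      apply lsum_nonneg; intros; apply Rmult_le_pos; auto; apply rpow_nonneg. }
  (* N^(1 - t) cancels, and t > 0 allows the t-th root to be taken. *)
  assert (hN4 : N <= C * rpow N U).
  { assert (hp := rpow_pos N U hN). assert (hq := rpow_pos N (1 - t) hN).
    apply rpow_le_inv with t; try lra; try (apply Rmult_le_pos; lra).
    apply Rmult_le_reg_r with (rpow N (1 - t)); auto.
    rewrite <- rpow_plus by lra. replace (t + (1 - t)) with 1 by ring. now rewrite rpow_1_r by lra. }
  apply rpow_le_inv with (/ la); try lra; try apply rpow_nonneg; try (apply Rinv_0_lt_compat; lra).
  rewrite rpow_inv_cancel by lra.
  replace (/ la) with (1 - U) by (unfold la; field; lra).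
  assert (hp := rpow_pos N U hN).
  apply Rmult_le_reg_r with (rpow N U); auto.
  rewrite <- rpow_plus by lra. replace (1 - U + U) with 1 by ring. now rewrite rpow_1_r by lra.
Qed.

End Marginals.

(* For U = 1/2 the exponent lambda is 2 and the argument above degenerates; freezing the weight
   M_j^(2 u_j) in one slot with u_j > 0 replaces u_j by 0. *)
Lemma marginal_bound (m n : nat) (L : list (list nat)) (A : list nat -> R) (u : nat -> R) (U C : R) :
  (forall l j, In l L -> (j < m)%nat -> (crd l j < n)%nat) -> (forall l, In l L -> 0 <= A l) ->
  (forall j, (j < m)%nat -> 0 <= u j) -> lsum (seq 0 m) u = U -> U <= / 2 -> 0 <= C ->
  weighted_bound m n L A u C ->
  forall k, (k < m)%nat ->
    lsum (seq 0 n) (fun i => rpow (fib L k i A) (/ (1 - U) / 2)) <= rpow C (/ (1 - U)).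
Proof.
  intros hL hA hu hU hU2 hC hw k hk.
  destruct hU2 as [hU2|hU2]; [now apply (marginal_bound_lt m n L A hL hA u)|].
  rewrite hU2. replace (/ (1 - / 2) / 2) with 1 by field. replace (/ (1 - / 2)) with 2 by field.
  assert (hSf : forall k i, 0 <= fib L k i A) by (intros; apply fib_nonneg; auto).
  (* At U = 1/2 the exponent is 2, so each marginal sum is the total mass of [A] and the claim no
     longer depends on k. *)
  assert (htot : forall k, (k < m)%nat -> lsum (seq 0 n) (fun i => fib L k i A) = lsum L A).
  { intros j hj. rewrite (lsum_ext _ _ (fun i => 1 * fib L j i A)) by (intros; ring).
    rewrite (lsum_fib n L j (fun _ => 1)) by auto. apply lsum_ext; intros; ring. }
  rewrite (lsum_ext _ _ (fun i => fib L k i A)), htot by (auto; intros; apply rpow_1_r; auto).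
  clear k hk.
  assert (hB0 : 0 <= lsum L A) by (apply lsum_nonneg; auto).
  destruct hB0 as [hB|hB]; [|rewrite <- hB; apply rpow_nonneg].
  set (B := lsum L A) in *.
  assert (hex : exists k, (k < m)%nat /\ 0 < u k).
  { destruct (list_argmax (seq 0 m) u) as (k & hk & hmax).
    - intros hnil. rewrite hnil in hU. simpl in hU. lra.
    - exists k. split; [apply in_seq in hk; lia|].
      destruct (Rlt_dec 0 (u k)) as [|hn]; auto.
      assert (lsum (seq 0 m) u <= lsum (seq 0 m) (fun _ => 0)).
      { apply lsum_le; intros j hj. specialize (hmax j hj). lra. }
      rewrite lsum_const in H. lra. }
  destruct hex as (k & hk & hv).
  set (v := u k) in *.
  assert (hvU : v <= U).
  { rewrite <- hU. apply (lsum_term_le (seq 0 m) u k); [|apply in_seq; lia].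
    intros j hj%in_seq; apply hu; lia. }
  pose (S := fun i => fib L k i A).
  assert (hS : forall i, 0 <= S i) by (intros; apply hSf).
  (* Here y^(1/v) = S / B sums to 1, so y is a norm-one weight for slot k. *)
  pose (y := fun i => rpow (S i) v * rpow B (- v)).
  assert (hy : forall i, 0 <= y i) by (intros; apply Rmult_le_pos; apply rpow_nonneg).
  pose (u' := fun j => if Nat.eqb j k then 0 else u j).
  pose (A' := fun l => A l * rpow (y (crd l k)) 2).
  assert (hU' : lsum (seq 0 m) u' = U - v).
  { rewrite (lsum_ext _ _ (fun j => u j + (-1) * (if Nat.eqb j k then u j else 0))).
    - rewrite lsum_plus, lsum_scal, hU, lsum_seq_single by auto. unfold v; ring.
    - intros j _. unfold u'. destruct (Nat.eqb j k); ring. }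
  assert (hyb : lsum (seq 0 n) (fun i => rpow (y i) (/ v)) = 1).
  { rewrite (lsum_ext _ _ (fun i => S i * rpow B (- (1)))).
    - unfold S. rewrite lsum_scal_r, htot by auto. fold B.
      rewrite rpow_Rpower, Rpower_Ropp, Rpower_1 by auto. field; lra.
    - intros i _. unfold y. rewrite rpow_mult_distr, rpow_inv_cancel, rpow_rpow; try apply rpow_nonneg; auto; try lra.
      f_equal; f_equal; field; lra. }
  assert (hw' : weighted_bound m n L A' u' C).
  { intros x hx hb j hj.
    (* In slot k the weights admissible for [u'] are bounded by 1, so their product with y is
       admissible for [u]; the resulting y^2 is the factor moved into [A']. *)
    pose (x' := fun j i => x j i * (if Nat.eqb j k then y i else 1)).
    eapply Rle_trans; [|apply (hw x') with (k := j); auto].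
    - apply Req_le, lsum_ext; intros i _. f_equal. apply fib_ext; intros l hl _.
      unfold A', x'.
      rewrite (lprod_ext _ (fun j0 => rpow (x j0 (crd l j0) * _) 2)
        (fun j0 => rpow (x j0 (crd l j0)) 2 * (if Nat.eqb j0 k then rpow (y (crd l k)) 2 else 1))).
      + rewrite lprod_mult, lprod_single by auto. ring.
      + intros j0 _. destruct (Nat.eqb_spec j0 k) as [->|].
        * apply rpow_mult_distr; auto.
        * rewrite !Rmult_1_r; auto.
    - intros j0 i. unfold x'. destruct (Nat.eqb j0 k); apply Rmult_le_pos; auto; lra.
    - intros j0 hj0. specialize (hb j0 hj0). unfold in_ball, u' in hb |- *. unfold x'.
      destruct (Nat.eqb_spec j0 k) as [e|]; [subst j0|].
      + destruct (Req_EM_T 0 0) as [_|]; [|lra]. fold v.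
        destruct (Req_EM_T v 0) as [|_]; [lra|].
        rewrite <- hyb. apply lsum_le; intros i hi%in_seq.
        apply rpow_le; [|left; apply Rinv_0_lt_compat; lra].
        split; [apply Rmult_le_pos; auto|].
        rewrite <- (Rmult_1_l (y i)) at 2. apply Rmult_le_compat_r; auto. apply hb; lia.
      + destruct (Req_EM_T (u j0) 0).
        * intros i hi. rewrite Rmult_1_r; auto.
        * rewrite (lsum_ext _ _ (fun i => rpow (x j0 i) (/ u j0))); auto.
          intros; now rewrite Rmult_1_r. }
  assert (hA' : forall l, In l L -> 0 <= A' l)
    by (intros; apply Rmult_le_pos; auto; apply rpow_nonneg).
  assert (hu' : forall j, (j < m)%nat -> 0 <= u' j)
    by (intros j hj; unfold u'; destruct (Nat.eqb j k); auto; lra).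
  assert (concl : lsum (seq 0 n) (fun i => rpow (fib L k i A') (/ (1 - (U - v)) / 2))
     <= rpow C (/ (1 - (U - v)))) by (apply (marginal_bound_lt m n L A' hL hA' u'); auto; lra).
  set (la := / (1 - (U - v))) in *.
  assert (hla : la * (/ 2 + v) = 1) by (unfold la; rewrite hU2; field; lra).
  assert (hla0 : 0 < la) by nra.
  apply rpow_le_inv with (la / 2); try apply rpow_nonneg; try lra.
  rewrite rpow_rpow by auto. replace (2 * (la / 2)) with la by field.
  eapply Rle_trans; [|exact concl]. apply Req_le.
  (* The marginal of [A'] is S y^2 = S^(1 + 2v) B^(-2v), and la = 2/(1 + 2v); its power la/2 is
     therefore S times a constant, and the sum is B^(1 - v la) = B^(la/2). *)
  rewrite (lsum_ext _ _ (fun i => S i * rpow B (- v * la))).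
  - unfold S. rewrite lsum_scal_r, htot by auto. fold B.
    rewrite <- (rpow_1_r B) at 2 by lra. rewrite <- rpow_plus by lra. f_equal. lra.
  - intros i _. unfold A'.
    rewrite (fib_ext _ _ _ _ (fun l => A l * rpow (y i) 2)) by (intros; subst; auto).
    rewrite fib_scal_r. fold (S i). unfold y.
    rewrite !rpow_mult_distr, !rpow_rpow; try apply rpow_nonneg; auto; try lra;
      try (apply Rmult_le_pos; apply rpow_nonneg).
    replace (- v * (2 * (la / 2))) with (- v * la) by field.
    rewrite <- Rmult_assoc, <- rpow_plus by auto.
    replace (la / 2 + v * (2 * (la / 2))) with 1 by lra. now rewrite rpow_1_r.
Qed.

(** * Mixed norms *)

Fixpoint tuples (n m : nat) : list (list nat) :=
  match m with
  | O => [[]]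
  | S m' => flat_map (fun i => map (cons i) (tuples n m')) (seq 0 n)
  end.

Lemma lsum_tuples_S n m F :
  lsum (tuples n (S m)) F = lsum (seq 0 n) (fun i => lsum (tuples n m) (fun l => F (i :: l))).
Proof.
  simpl. rewrite lsum_flat_map. apply lsum_ext; intros; apply lsum_map.
Qed.

Lemma in_tuples_S n m l : In l (tuples n (S m)) <->
  exists i l', l = i :: l' /\ (i < n)%nat /\ In l' (tuples n m).
Proof.
  simpl. rewrite in_flat_map. split.
  - intros (i & hi%in_seq & (l' & <- & hl)%in_map_iff). exists i, l'; repeat split; auto; lia.
  - intros (i & l' & -> & hi & hl). exists i. split; [apply in_seq; lia|]. now apply in_map.
Qed.

Lemma in_tuples n m l :
  In l (tuples n m) <-> length l = m /\ forall j, (j < m)%nat -> (crd l j < n)%nat.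
Proof.
  revert l; induction m as [|m IH]; intros l.
  - simpl. split; [intros [<-|[]]; split; auto; lia|].
    intros [h _]. left. now destruct l.
  - rewrite in_tuples_S. split.
    + intros (i & l' & -> & hi & hl). apply IH in hl as [h1 h2]. split; [simpl; lia|].
      intros [|j] hj; [exact hi|]. apply (h2 j); lia.
    + intros [h1 h2]. destruct l as [|i l']; [discriminate|].
      exists i, l'. split; auto. split; [apply (h2 O); lia|].
      apply IH. split; [simpl in h1; lia|]. intros j hj. apply (h2 (S j)); lia.
Qed.

Lemma NoDup_tuples n m : NoDup (tuples n m).
Proof.
  induction m as [|m IH]; [repeat constructor; simpl; tauto|].
  simpl. generalize (seq_NoDup n 0). generalize (seq 0 n).
  induction l as [|i l IHl]; intros hnd; [constructor|].
  inversion_clear hnd. simpl. apply NoDup_app; auto.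
  - apply FinFun.Injective_map_NoDup; auto. intros x y; congruence.
  - intros x (x' & <- & _)%in_map_iff (j & hj & (x'' & e & _)%in_map_iff)%in_flat_map.
    congruence.
Qed.

(** The mixed norm with slot 0 outermost. A root is taken at every level, unlike in [mixed_aux], so
    that each level is itself a mixed norm and inductions on m peel off the outer slot. *)
Fixpoint mx (n m : nat) (q : nat -> R) (a : list nat -> R) : R :=
  match m with
  | O => a nil
  | S m' => rpow (lsum (seq 0 n) (fun i =>
              rpow (mx n m' (fun j => q (S j)) (fun l => a (i :: l))) (q O))) (/ q O)
  end.

Lemma mx_nonneg n m q a : (forall l, 0 <= a l) -> 0 <= mx n m q a.
Proof. intros h; destruct m; simpl; auto; apply rpow_nonneg. Qed.

Lemma mx_ext n m q q' a a' : (forall j, (j < m)%nat -> q j = q' j) ->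
  (forall l, In l (tuples n m) -> a l = a' l) -> mx n m q a = mx n m q' a'.
Proof.
  revert q q' a a'; induction m as [|m IH]; intros q q' a a' hq ha; simpl.
  - apply ha; simpl; auto.
  - rewrite (hq O) by lia. f_equal. apply lsum_ext; intros i hi%in_seq. f_equal.
    apply IH; [intros; apply hq; lia|]. intros l hl. apply ha.
    apply in_tuples_S. exists i, l. repeat split; auto; lia.
Qed.

Section Mixed.
Variable n : nat.

(** Iterated Hölder: the inductive hypothesis handles the inner norms, and in the outer slot the
    weights th_k q_0 / Q_k0 add up to 1 by the relation between the exponents. *)
Lemma mx_holder {B} (J : list B) (th : B -> R) m (Q : B -> nat -> R) (q : nat -> R)
    (a : B -> list nat -> R) :
  (forall k, In k J -> 0 <= th k) -> (forall k j, 0 < Q k j) -> (forall j, 0 < q j) ->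
  (forall j, (j < m)%nat -> / q j = lsum J (fun k => th k / Q k j)) ->
  (forall k l, 0 <= a k l) ->
  mx n m q (fun l => lprod J (fun k => rpow (a k l) (th k)))
  <= lprod J (fun k => rpow (mx n m (Q k) (a k)) (th k)).
Proof.
  intros hth. revert Q q a; induction m as [|m IH]; intros Q q a hQ hq hqQ ha; simpl; [lra|].
  assert (hq0 := hq O).
  pose (M := fun k i => mx n m (fun j => Q k (S j)) (fun l => a k (i :: l))).
  assert (hM : forall k i, 0 <= M k i) by (intros; apply mx_nonneg; auto).
  pose (w := fun k => th k * q O / Q k O).
  apply Rle_trans with
    (rpow (lsum (seq 0 n) (fun i => lprod J (fun k => rpow (rpow (M k i) (Q k O)) (w k)))) (/ q O)).
  - apply rpow_le; [|left; now apply Rinv_0_lt_compat].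
    split; [apply lsum_nonneg; intros; apply rpow_nonneg|].
    apply lsum_le; intros i _.
    apply Rle_trans with (rpow (lprod J (fun k => rpow (M k i) (th k))) (q O)).
    + apply rpow_le; [|lra]. split.
      * apply mx_nonneg; intros; apply lprod_nonneg; intros; apply rpow_nonneg.
      * apply (IH (fun k j => Q k (S j)) (fun j => q (S j)) (fun k l => a k (i :: l))); auto.
        intros; apply hqQ; lia.
    + rewrite lprod_rpow by (intros; apply rpow_nonneg). apply Req_le, lprod_ext; intros k _.
      specialize (hQ k O). rewrite !rpow_rpow by auto. f_equal. unfold w; field; lra.
  - apply Rle_trans with (rpow (lprod J (fun k =>
      rpow (lsum (seq 0 n) (fun i => rpow (M k i) (Q k O))) (w k))) (/ q O)).
    + apply rpow_le; [|left; now apply Rinv_0_lt_compat]. split.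
      * apply lsum_nonneg; intros; apply lprod_nonneg; intros; apply rpow_nonneg.
      * apply (holder _ _ (fun k i => rpow (M k i) (Q k O))).
        -- intros; apply rpow_nonneg.
        -- intros k hk. apply Rdiv_nonneg; auto. apply Rmult_le_pos; auto; lra.
        -- rewrite (lsum_ext _ _ (fun k => q O * (th k / Q k O)))
             by (intros k _; unfold w; specialize (hQ k O); field; lra).
           rewrite lsum_scal, <- hqQ by lia. field; lra.
    + rewrite lprod_rpow by (intros; apply rpow_nonneg). apply Req_le, lprod_ext; intros k _.
      specialize (hQ k O).
      assert (h : 0 <= lsum (seq 0 n) (fun i => rpow (M k i) (Q k O)))
        by (apply lsum_nonneg; intros; apply rpow_nonneg).
      rewrite !rpow_rpow by exact h. unfold M. f_equal. unfold w; field; lra.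
Qed.

(** * Comparison and interpolation of exponents *)

Lemma power_mean (f : nat -> R) (r q : R) : (forall i, 0 <= f i) -> 0 < r <= q ->
  rpow (lsum (seq 0 n) (fun i => rpow (f i) r)) (/ r)
  <= rpow (INR n) (/ r - / q) * rpow (lsum (seq 0 n) (fun i => rpow (f i) q)) (/ q).
Proof.
  intros hf hrq.
  set (Sq := lsum _ (fun i => rpow (f i) q)).
  assert (hSq : 0 <= Sq) by (apply lsum_nonneg; intros; apply rpow_nonneg).
  assert (hrq' : 0 <= r / q <= 1).
  { split; [apply Rdiv_nonneg; lra|]. apply Rmult_le_reg_r with q; [lra|].
    unfold Rdiv. rewrite Rmult_assoc, Rinv_l; lra. }
  apply Rle_trans with (rpow (rpow Sq (r / q) * rpow (INR n) (1 - r / q)) (/ r)).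
  - apply rpow_le; [|left; apply Rinv_0_lt_compat; lra].
    split; [apply lsum_nonneg; intros; apply rpow_nonneg|].
    (* Hölder's inequality against the constant 1, which contributes n^(1 - r/q). *)
    rewrite (lsum_ext _ _ (fun i => rpow (rpow (f i) q) (r / q) * rpow 1 (1 - r / q))).
    + eapply Rle_trans; [apply holder2; auto; intros; try apply rpow_nonneg; lra|].
      fold Sq. rewrite lsum_const, length_seq, Rmult_1_r. lra.
    + intros i _. rewrite rpow_1_l, Rmult_1_r, rpow_rpow by auto. f_equal. field; lra.
  - rewrite rpow_mult_distr, !rpow_rpow; try apply rpow_nonneg; auto using pos_INR.
    apply Req_le. rewrite Rmult_comm. f_equal; f_equal; field; lra.
Qed.

(** Every f(i) is at most the l_q norm of f, so f^r is at most f^q times the (r - q)-th power of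
    that norm. *)
Lemma power_sum_antitone (f : nat -> R) (r q : R) : (forall i, 0 <= f i) -> 0 < q <= r ->
  rpow (lsum (seq 0 n) (fun i => rpow (f i) r)) (/ r)
  <= rpow (lsum (seq 0 n) (fun i => rpow (f i) q)) (/ q).
Proof.
  intros hf hrq.
  set (Sq := lsum _ (fun i => rpow (f i) q)).
  assert (hSq : 0 <= Sq) by (apply lsum_nonneg; intros; apply rpow_nonneg).
  apply rpow_le_inv with r; try apply rpow_nonneg; try lra.
  rewrite rpow_inv_cancel', rpow_rpow;
    [|auto|apply lsum_nonneg; intros; apply rpow_nonneg|lra].
  apply Rle_trans with (lsum (seq 0 n) (fun i => rpow (f i) q * rpow Sq ((r - q) / q))).
  - apply lsum_le; intros i hi. replace r with (q + (r - q)) at 1 by ring.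
    rewrite rpow_plus by auto. apply Rmult_le_compat_l; [apply rpow_nonneg|].
    replace ((r - q) / q) with (/ q * (r - q)) by (field; lra).
    rewrite <- rpow_rpow by auto. apply rpow_le; [|lra]. split; auto.
    apply rpow_le_inv with q; auto; try lra; try apply rpow_nonneg.
    rewrite rpow_inv_cancel' by lra.
    apply (lsum_term_le _ (fun i => rpow (f i) q)); auto. intros; apply rpow_nonneg.
  - rewrite lsum_scal_r. fold Sq. rewrite <- (rpow_1_r Sq) at 1 by auto.
    rewrite <- rpow_plus by auto. apply Req_le. f_equal. field; lra.
Qed.

Lemma mx_power_mean m r q a : (1 <= n)%nat -> (forall l, 0 <= a l) ->
  (forall j, 0 < r j) -> (forall j, 0 < q j) -> (forall j, (j < m)%nat -> r j <= q j) ->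
  mx n m r a <= rpow (INR n) (lsum (seq 0 m) (fun j => / r j - / q j)) * mx n m q a.
Proof.
  intros hn. assert (hn' : 0 < INR n) by (apply lt_0_INR; lia).
  revert r q a; induction m as [|m IH]; intros r q a ha hr hq hrq.
  - simpl. rewrite rpow_0_r; lra.
  - rewrite lsum_seq_shift, rpow_plus by lra.
    set (c := rpow (INR n) (lsum _ _)). simpl.
    assert (hc : 0 <= c) by apply rpow_nonneg.
    assert (hr0 := hr O). assert (hq0 := hq O).
    eapply Rle_trans; [|rewrite Rmult_assoc; apply Rmult_le_compat_l; [apply rpow_nonneg|]].
    + apply power_mean; [intros; apply mx_nonneg; auto|]. split; auto. apply hrq; lia.
    + apply Rle_trans with (rpow (lsum (seq 0 n) (fun i => rpow (c * mx n m (fun j => q (S j)) (fun l => a (i :: l))) (q O))) (/ q O)).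
      * apply rpow_le; [|left; now apply Rinv_0_lt_compat].
        split; [apply lsum_nonneg; intros; apply rpow_nonneg|].
        apply lsum_le; intros i _. apply rpow_le; [|lra].
        split; [apply mx_nonneg; auto|].
        apply (IH (fun j => r (S j)) (fun j => q (S j))); auto. intros; apply hrq; lia.
      * apply Req_le. rewrite (lsum_ext _ _ (fun i => rpow c (q O) *
           rpow (mx n m (fun j => q (S j)) (fun l => a (i :: l))) (q O))).
        -- rewrite lsum_scal, rpow_mult_distr, rpow_inv_cancel; auto; try lra; try apply rpow_nonneg.
           apply lsum_nonneg; intros; apply rpow_nonneg.
        -- intros i _. apply rpow_mult_distr; auto. apply mx_nonneg; auto.
Qed.

Lemma mx_antitone m r q a : (forall l, 0 <= a l) ->
  (forall j, 0 < r j) -> (forall j, 0 < q j) -> (forall j, (j < m)%nat -> q j <= r j) ->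
  mx n m r a <= mx n m q a.
Proof.
  revert r q a; induction m as [|m IH]; intros r q a ha hr hq hrq; simpl; [lra|].
  assert (hr0 := hr O). assert (hq0 := hq O).
  eapply Rle_trans.
  - apply power_sum_antitone with (q := q O); [intros; apply mx_nonneg; auto|].
    split; auto. apply hrq; lia.
  - apply rpow_le; [|left; now apply Rinv_0_lt_compat].
    split; [apply lsum_nonneg; intros; apply rpow_nonneg|].
    apply lsum_le; intros i _. apply rpow_le; [|lra].
    split; [apply mx_nonneg; auto|].
    apply (IH (fun j => r (S j)) (fun j => q (S j))); auto. intros; apply hrq; lia.
Qed.

Lemma mx_two m a : (forall l, 0 <= a l) ->
  mx n m (fun _ => 2) a = rpow (lsum (tuples n m) (fun l => rpow (a l) 2)) (/ 2).
Proof.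
  revert a; induction m as [|m IH]; intros a ha.
  - simpl. rewrite Rplus_0_r, rpow_inv_cancel; auto; lra.
  - rewrite lsum_tuples_S. simpl. f_equal. apply lsum_ext; intros i _.
    rewrite IH, rpow_inv_cancel' by (auto; try lra; apply lsum_nonneg; intros; apply rpow_nonneg).
    reflexivity.
Qed.

(** For k = 0 the inner l_2 norms collapse to the marginal and equality holds. Otherwise an outer
    l_2 sum has to move inside the l_la sum: this is Minkowski's inequality with exponent 2 / la,
    which is at least 1 because la <= 2. *)
Lemma mx_endpoint m k la a : (k < m)%nat -> 1 <= la <= 2 -> (forall l, 0 <= a l) ->
  mx n m (fun j => if Nat.eqb j k then la else 2) a
  <= rpow (lsum (seq 0 n) (fun i =>
       rpow (fib (tuples n m) k i (fun l => rpow (a l) 2)) (la / 2))) (/ la).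
Proof.
  intros hk hla. assert (hil : 0 < / la) by (apply Rinv_0_lt_compat; lra).
  revert k a hk; induction m as [|m IH]; intros k a hk ha; [lia|].
  destruct k as [|k].
  - cbn [mx Nat.eqb]. rewrite (lsum_ext _ _ (fun i =>
       rpow (fib (tuples n (S m)) 0 i (fun l => rpow (a l) 2)) (la / 2))); [lra|].
    intros i hi%in_seq. rewrite mx_two by auto. rewrite rpow_rpow
      by (apply lsum_nonneg; intros; apply rpow_nonneg).
    unfold fib. rewrite lsum_tuples_S.
    rewrite (lsum_ext _ (fun i0 => lsum _ _) (fun i0 => if Nat.eqb i0 i then
      lsum (tuples n m) (fun l => rpow (a (i0 :: l)) 2) else 0)).
    + rewrite (lsum_seq_single n i (fun i0 => lsum (tuples n m) (fun l => rpow (a (i0 :: l)) 2))) by lia.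
      f_equal. field.
    + intros i0 _. unfold crd; simpl. destruct (Nat.eqb i0 i); auto.
      rewrite lsum_const; ring.
  - cbn [mx Nat.eqb].
    pose (g := fun i0 i => rpow (fib (tuples n m) k i (fun l => rpow (a (i0 :: l)) 2)) (la / 2)).
    assert (hg : forall i0 i, 0 <= g i0 i) by (intros; apply rpow_nonneg).
    assert (hf : forall i0 i, 0 <= fib (tuples n m) k i (fun l => rpow (a (i0 :: l)) 2))
      by (intros; apply fib_nonneg; intros; apply rpow_nonneg).
    apply Rle_trans with
      (rpow (lsum (seq 0 n) (fun i0 => rpow (lsum (seq 0 n) (g i0)) (2 / la))) (/ 2)).
    + apply rpow_le; [|lra]. split; [apply lsum_nonneg; intros; apply rpow_nonneg|].
      apply lsum_le; intros i0 _. unfold Rdiv. rewrite (Rmult_comm 2), <- rpow_rpow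
        by (apply lsum_nonneg; auto).
      apply rpow_le; [|lra]. split; [apply mx_nonneg; auto|].
      apply IH; auto; lia.
    + assert (hs : 1 <= 2 / la).
      { apply Rmult_le_reg_r with la; [lra|]. unfold Rdiv. rewrite Rmult_assoc, Rinv_l; lra. }
      assert (hmk := minkowski (seq 0 n) (seq 0 n) g (2 / la) hs (fun x y _ _ => hg x y)).
      replace (/ 2) with (/ (2 / la) * / la) by (field; lra).
      rewrite <- rpow_rpow by (apply lsum_nonneg; intros; apply rpow_nonneg).
      apply rpow_le; [|lra]. split; [apply rpow_nonneg|].
      eapply Rle_trans; [exact hmk|]. apply Req_le, lsum_ext; intros i _.
      unfold fib at 1. rewrite lsum_tuples_S.
      replace (/ (2 / la)) with (la / 2) by (field; lra). f_equal.
      apply lsum_ext; intros i0 _. unfold g. rewrite rpow_rpow by auto.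
      replace (la / 2 * (2 / la)) with 1 by (field; lra). rewrite rpow_1_r; auto.
Qed.

(** The relation reads 1/q_j = th_j / la + (1 - th_j) / 2, so in reciprocals q is a convex
    combination of the m endpoints. Hölder's inequality applied to a = prod_k a^(th_k) combines
    their bounds. *)
Lemma mx_interpolate m th la q a B : 0 < la -> (forall k, (k < m)%nat -> 0 <= th k) ->
  lsum (seq 0 m) th = 1 -> (forall j, 0 < q j) ->
  (forall j, (j < m)%nat -> / q j = / 2 + th j * (/ la - / 2)) ->
  (forall l, 0 <= a l) -> 0 <= B ->
  (forall k, (k < m)%nat -> mx n m (fun j => if Nat.eqb j k then la else 2) a <= B) ->
  mx n m q a <= B.
Proof.
  intros hla hth hs hq hqe ha hB hb.
  assert (hth' : forall k, In k (seq 0 m) -> 0 <= th k) by (intros k hk%in_seq; apply hth; lia).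
  assert (hm : (0 < m)%nat) by (destruct m; [simpl in hs; lra|lia]).
  rewrite (mx_ext n m q q a (fun l => lprod (seq 0 m) (fun k => rpow (a l) (th k)))); auto.
  2:{ intros l _. destruct (ha l) as [h|h].
      - rewrite lprod_rpow_const, hs, rpow_1_r; lra.
      - rewrite <- h, (lprod_zero _ _ O); auto using rpow_zero. apply in_seq; lia. }
  eapply Rle_trans.
  - apply (mx_holder (seq 0 m) th m (fun k j => if Nat.eqb j k then la else 2) q (fun _ => a)); auto.
    + intros k j; destruct (Nat.eqb j k); lra.
    + intros j hj. rewrite hqe by auto.
      rewrite (lsum_ext _ _ (fun k => / 2 * th k + (if Nat.eqb k j then th k * (/ la - / 2) else 0))).
      * rewrite lsum_plus, lsum_scal, hs, (lsum_seq_single m j (fun k => th k * (/ la - / 2))) by auto. ring.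
      * intros k _. rewrite (Nat.eqb_sym k). destruct (Nat.eqb j k); field; lra.
  - apply Rle_trans with (lprod (seq 0 m) (fun k => rpow B (th k))).
    + apply lprod_le; intros k hk. split; [apply rpow_nonneg|].
      apply rpow_le; auto. split; [apply mx_nonneg; auto|]. apply hb. apply in_seq in hk; lia.
    + destruct hB as [hB|<-].
      * rewrite lprod_rpow_const, hs, rpow_1_r; lra.
      * rewrite (lprod_zero _ _ O); auto using rpow_zero; [lra|]. apply in_seq; lia.
Qed.

(** The excess of 1/r_j over 1/2 is [rho j], that of the reciprocal endpoint exponent is [de].
    Weights th_j proportional to [rho j] make 1/q_j - 1/2 = (de / sr) rho_j, so r and q compare in
    the same direction in all slots: either the l_r norm is controlled with a power of n throughout,
    or without loss throughout. *)
Lemma mx_bound m r U a B : (0 < m)%nat -> (1 <= n)%nat ->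
  (forall j, (j < m)%nat -> 1 <= r j <= 2) -> 0 <= U <= / 2 ->
  (forall l, 0 <= a l) -> 0 <= B ->
  (forall k, (k < m)%nat -> mx n m (fun j => if Nat.eqb j k then / (1 - U) else 2) a <= B) ->
  mx n m r a
  <= rpow (INR n) (Rmax (lsum (seq 0 m) (fun j => / r j) - (INR m + 1) / 2 + U) 0) * B.
Proof.
  intros hm hn hr hU ha hB hb.
  assert (hn1 : 1 <= INR n) by (now apply (le_INR 1)).
  assert (hm1 : 1 <= INR m) by (now apply (le_INR 1)).
  set (E := lsum _ _ - _ + U).
  (* Outside the slots the exponent is set to 1, since the comparison lemmas ask for positivity at
     every index. *)
  pose (r' := fun j => if Nat.ltb j m then r j else 1).
  assert (hr' : forall j, 1 <= r' j <= 2).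
  { intros j; unfold r'. destruct (Nat.ltb_spec j m); auto; lra. }
  assert (hr'e : forall j, (j < m)%nat -> r j = r' j).
  { intros j hj; unfold r'. destruct (Nat.ltb_spec j m); auto; lia. }
  rewrite (mx_ext n m r r' a a) by auto.
  pose (rho := fun j => / r' j - / 2).
  assert (hrho : forall j, 0 <= rho j).
  { intros j; unfold rho. assert (/ 2 <= / r' j); [|lra].
    specialize (hr' j). apply Rinv_le_contravar; lra. }
  pose (sr := lsum (seq 0 m) rho).
  assert (hR : 0 <= sr) by (apply lsum_nonneg; auto).
  pose (de := / 2 - U).
  assert (hE : E = sr - de).
  { unfold E, sr, rho, de, Rminus. rewrite lsum_plus, lsum_const, length_seq.
    rewrite (lsum_ext _ (fun j => / r j) (fun j => / r' j)); [field|].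
    intros j hj%in_seq. rewrite hr'e; auto; lia. }
  (* If [sr = 0], every [rho j] vanishes and any weights adding up to 1 will do. *)
  pose (th := fun j => if Req_EM_T sr 0 then / INR m else rho j / sr).
  assert (hth : forall j, 0 <= th j).
  { intros j. unfold th. destruct (Req_EM_T sr 0).
    - left; apply Rinv_0_lt_compat; lra.
    - apply Rdiv_nonneg; auto; lra. }
  assert (hths : lsum (seq 0 m) th = 1).
  { unfold th. destruct (Req_EM_T sr 0).
    - rewrite lsum_const, length_seq. field; lra.
    - unfold Rdiv. rewrite lsum_scal_r. fold sr. field; auto. }
  pose (q := fun j => / (/ 2 + th j * de)).
  assert (hqp : forall j, 0 < / 2 + th j * de).
  { intros j. specialize (hth j). assert (0 <= th j * de) by (apply Rmult_le_pos; unfold de; lra). lra. }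
  assert (hq : forall j, 0 < q j) by (intros; apply Rinv_0_lt_compat; auto).
  assert (hqB : mx n m q a <= B).
  { apply (mx_interpolate m th (/ (1 - U))); auto.
    - apply Rinv_0_lt_compat; lra.
    - intros j _. unfold q, de. rewrite !Rinv_inv. f_equal. f_equal. field. }
  assert (hr0 : forall j, 0 < r' j) by (intros j; specialize (hr' j); lra).
  assert (hcmp : forall j, (j < m)%nat -> (de <= sr -> th j * de <= rho j) /\ (sr <= de -> rho j <= th j * de)).
  { intros j hj. unfold th. destruct (Req_EM_T sr 0) as [h0|h0].
    - assert (hz : rho j = 0).
      { apply (lsum_zero_term (seq 0 m) rho j); auto. apply in_seq; lia. }
      assert (0 < / INR m) by (apply Rinv_0_lt_compat; lra). rewrite hz, h0.
      split; unfold de; intros; [assert (/ 2 - U = 0) by lra; nra|nra].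
    - assert (hp : 0 < sr) by lra. specialize (hrho j).
      assert (0 <= rho j / sr) by (apply Rdiv_nonneg; auto).
      assert (e : rho j = rho j / sr * sr) by (field; lra).
      split; intros hdR.
      + apply Rle_trans with (rho j / sr * sr); [apply Rmult_le_compat_l; auto|lra].
      + apply Rle_trans with (rho j / sr * sr); [lra|apply Rmult_le_compat_l; auto]. }
  destruct (Rle_dec de sr) as [hc|hc].
  - eapply Rle_trans; [apply (mx_power_mean m r' q); auto|].
    + intros j hj. destruct (hcmp j hj) as [h _]. specialize (h hc).
      unfold q. rewrite <- (Rinv_inv (r' j)). apply Rinv_le_contravar; auto.
      unfold rho in h. lra.
    + rewrite (lsum_ext _ _ (fun j => rho j + (- de) * th j)).
      * rewrite lsum_plus, lsum_scal, hths. fold sr.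
        apply Rmult_le_compat; auto; [apply rpow_nonneg|apply mx_nonneg; auto|].
        apply rpow_monotone; auto. rewrite hE. eapply Rle_trans; [|apply Rmax_l]. lra.
      * intros j _. unfold q, rho. rewrite Rinv_inv. ring.
  - eapply Rle_trans; [apply (mx_antitone m r' q); auto|].
    + intros j hj. destruct (hcmp j hj) as [_ h]. specialize (h ltac:(lra)).
      unfold q. rewrite <- (Rinv_inv (r' j)). apply Rinv_le_contravar; [apply Rinv_0_lt_compat; auto|].
      unfold rho in h. lra.
    + rewrite <- (Rmult_1_l (mx n m q a)).
      apply Rmult_le_compat; auto; try lra; [apply mx_nonneg; auto|].
      rewrite <- (rpow_0_r (INR n)) by lra. apply rpow_monotone; auto. apply Rmax_r.
Qed.
End Mixed.

(** * Khinchine's inequality in a Hilbert space *)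

(** The expectation over n independent signs, computed by halving; the coordinates from n on are
    1. *)
Fixpoint sign_mean (n : nat) (f : (nat -> R) -> R) : R :=
  match n with
  | O => f (fun _ => 1)
  | S k => (sign_mean k (fun e => f (upd e k 1)) + sign_mean k (fun e => f (upd e k (-1)))) / 2
  end.

Definition is_sign (e : nat -> R) : Prop := forall i, e i = 1 \/ e i = -1.

Lemma is_sign_upd e k s : is_sign e -> s = 1 \/ s = -1 -> is_sign (upd e k s).
Proof. intros he hs i. unfold upd. destruct (Nat.eqb i k); auto. Qed.

Lemma sign_mean_le n f g : (forall e, f e <= g e) -> sign_mean n f <= sign_mean n g.
Proof.
  revert f g; induction n; intros f g h; simpl; auto.
  assert (h1 := IHn (fun e => f (upd e n 1)) (fun e => g (upd e n 1)) (fun e => h _)).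
  assert (h2 := IHn (fun e => f (upd e n (-1))) (fun e => g (upd e n (-1))) (fun e => h _)). lra.
Qed.

Lemma sign_mean_ext n f g : (forall e, f e = g e) -> sign_mean n f = sign_mean n g.
Proof. intros h; apply Rle_antisym; apply sign_mean_le; intros; rewrite h; lra. Qed.

Lemma sign_mean_plus n f g : sign_mean n (fun e => f e + g e) = sign_mean n f + sign_mean n g.
Proof.
  revert f g; induction n; intros f g; simpl; auto.
  rewrite (IHn (fun e => f (upd e n 1)) (fun e => g (upd e n 1))),
    (IHn (fun e => f (upd e n (-1))) (fun e => g (upd e n (-1)))). field.
Qed.

Lemma sign_mean_scal n c f : sign_mean n (fun e => c * f e) = c * sign_mean n f.
Proof.
  revert f; induction n; intros f; simpl; auto.
  rewrite (IHn (fun e => f (upd e n 1))), (IHn (fun e => f (upd e n (-1)))). field.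
Qed.

Lemma sign_mean_const n c : sign_mean n (fun _ => c) = c.
Proof. induction n; simpl; auto. rewrite IHn. field. Qed.

Lemma sign_mean_lsum {A} n (L : list A) f :
  sign_mean n (fun e => lsum L (fun a => f a e)) = lsum L (fun a => sign_mean n (f a)).
Proof.
  induction L; simpl; [apply sign_mean_const|]. now rewrite sign_mean_plus, IHL.
Qed.

Lemma sign_mean_attained n f : exists e, is_sign e /\ sign_mean n f <= f e.
Proof.
  revert f; induction n; intros f; simpl.
  - exists (fun _ => 1). split; [intros i; auto|lra].
  - destruct (IHn (fun e => f (upd e n 1))) as (e1 & h1 & h1').
    destruct (IHn (fun e => f (upd e n (-1)))) as (e2 & h2 & h2').
    destruct (Rle_dec (f (upd e2 n (-1))) (f (upd e1 n 1))).
    + exists (upd e1 n 1). split; [apply is_sign_upd; auto|lra].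
    + exists (upd e2 n (-1)). split; [apply is_sign_upd; auto|lra].
Qed.

Section Hilbert.
Context {A : Type} (L : list A).

Definition nsq (x : A -> R) : R := lsum L (fun a => x a * x a).
Definition rsum (n : nat) (v : nat -> A -> R) (e : nat -> R) (a : A) : R :=
  lsum (seq 0 n) (fun i => e i * v i a).

Lemma nsq_nonneg x : 0 <= nsq x.
Proof. apply lsum_nonneg; intros; apply Rle_0_sqr. Qed.

Lemma nsq_rsum_S n v e s : nsq (rsum (S n) v (upd e n s))
  = nsq (rsum n v e) + 2 * s * lsum L (fun a => rsum n v e a * v n a) + s * s * nsq (v n).
Proof.
  unfold nsq. rewrite <- !lsum_scal, <- !lsum_plus. apply lsum_ext; intros a _.
  replace (rsum (S n) v (upd e n s) a) with (rsum n v e a + s * v n a); [ring|].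
  unfold rsum. rewrite lsum_seq_S. f_equal.
  - apply lsum_ext; intros i hi%in_seq. unfold upd. destruct (Nat.eqb_spec i n); [lia|auto].
  - unfold upd. now rewrite Nat.eqb_refl.
Qed.

Lemma second_moment n v : sign_mean n (fun e => nsq (rsum n v e)) = lsum (seq 0 n) (fun i => nsq (v i)).
Proof.
  induction n.
  - simpl. unfold nsq, rsum; simpl. rewrite lsum_const; ring.
  - rewrite lsum_seq_S, <- IHn. cbn [sign_mean].
    rewrite (sign_mean_ext n (fun e => nsq (rsum (S n) v (upd e n 1))) _ (fun e => nsq_rsum_S n v e 1)),
      (sign_mean_ext n (fun e => nsq (rsum (S n) v (upd e n (-1)))) _ (fun e => nsq_rsum_S n v e (-1))).
    rewrite !sign_mean_plus, !sign_mean_scal, !sign_mean_const. field.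
Qed.

(** Averaging over the new sign removes the odd terms and leaves X^2 + 2 s X + s^2 + 4 P^2, where
    P^2 <= s X by Cauchy-Schwarz. The induction closes because 6 s SS + s^2 <= 3 ((SS + s)^2 -
    SS^2). *)
Lemma fourth_moment n v :
  sign_mean n (fun e => nsq (rsum n v e) ^ 2) <= 3 * (lsum (seq 0 n) (fun i => nsq (v i))) ^ 2.
Proof.
  induction n.
  - simpl. unfold nsq, rsum; simpl. rewrite lsum_const; lra.
  - rewrite lsum_seq_S. cbn [sign_mean].
    set (s := nsq (v n)). assert (hs : 0 <= s) by apply nsq_nonneg.
    set (SS := lsum _ _) in *. assert (hS : 0 <= SS) by (apply lsum_nonneg; intros; apply nsq_nonneg).
    assert (e : forall x y, (x + y) / 2 = / 2 * (x + y)) by (intros; field).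
    rewrite e, <- sign_mean_plus, <- sign_mean_scal.
    apply Rle_trans with (sign_mean n (fun e => nsq (rsum n v e) ^ 2 + (6 * s * nsq (rsum n v e) + s ^ 2))).
    + apply sign_mean_le; intros w. rewrite !nsq_rsum_S. fold s.
      assert (hcs := cauchy_schwarz L (rsum n v w) (v n)).
      fold (nsq (rsum n v w)) (nsq (v n)) in hcs. fold s in hcs.
      set (X := nsq (rsum n v w)) in *. set (P := lsum L _) in *. nra.
    + rewrite !sign_mean_plus, sign_mean_scal, sign_mean_const, second_moment. fold SS. nra.
Qed.

(** The minorant u >= 3u^2/4 - u^4/16 converts the second moment 1 and a fourth moment at most 3
    into a first moment at least 3/4 - 3/16 = 9/16, more than the 1/2 claimed. The vectors live in a
    Hilbert space so that the remaining coordinates of a tensor are carried along. *)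
Lemma khinchine_mean n v :
  sqrt (lsum (seq 0 n) (fun i => nsq (v i))) <= 2 * sign_mean n (fun e => sqrt (nsq (rsum n v e))).
Proof.
  set (SS := lsum _ _). assert (hS : 0 <= SS) by (apply lsum_nonneg; intros; apply nsq_nonneg).
  destruct hS as [hS|hS].
  2:{ rewrite <- hS, sqrt_0. rewrite <- sign_mean_scal, <- (sign_mean_const n 0).
      apply sign_mean_le; intros. assert (h := sqrt_pos (nsq (rsum n v e))). lra. }
  set (sg := sqrt SS). assert (hsg : 0 < sg) by now apply sqrt_lt_R0.
  assert (hsg2 : sg * sg = SS) by (apply sqrt_sqrt; lra).
  assert (key : sign_mean n (fun e => 3 / (4 * sg) * nsq (rsum n v e)
      + - / (16 * sg ^ 3) * nsq (rsum n v e) ^ 2) <= sign_mean n (fun e => sqrt (nsq (rsum n v e)))).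
  { (* 1 - 3u/4 + u^3/16 = (u - 2)^2 (u + 4) / 16 with u = |X| / sg *)
    apply sign_mean_le; intros e. set (q := nsq (rsum n v e)).
    assert (hq : 0 <= q) by apply nsq_nonneg.
    assert (hw := sqrt_sqrt q hq). assert (hw0 := sqrt_pos q). set (w := sqrt q) in *.
    rewrite <- hw.
    assert (h : 0 <= w * ((w - 2 * sg) ^ 2 * (w + 4 * sg)) / (16 * sg ^ 3)).
    { apply Rdiv_nonneg; [|assert (0 < sg ^ 3) by (apply pow_lt; auto); lra].
      apply Rmult_le_pos; auto. apply Rmult_le_pos; [apply pow2_ge_0|lra]. }
    replace (w * ((w - 2 * sg) ^ 2 * (w + 4 * sg)) / (16 * sg ^ 3))
      with (w - (3 / (4 * sg) * (w * w) + - / (16 * sg ^ 3) * (w * w) ^ 2)) in h by (field; lra).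
    lra. }
  rewrite sign_mean_plus, !sign_mean_scal, second_moment in key. fold SS in key.
  assert (h4 := fourth_moment n v). fold SS in h4.
  assert (hp : 0 < / (16 * sg ^ 3)) by (apply Rinv_0_lt_compat; assert (0 < sg ^ 3) by (apply pow_lt; auto); lra).
  assert (h5 : 3 / (4 * sg) * SS - / (16 * sg ^ 3) * (3 * SS ^ 2) = 9 / 16 * sg)
    by (rewrite <- hsg2; field; lra).
  assert (/ (16 * sg ^ 3) * sign_mean n (fun e => nsq (rsum n v e) ^ 2) <= / (16 * sg ^ 3) * (3 * SS ^ 2))
    by (apply Rmult_le_compat_l; lra).
  lra.
Qed.
End Hilbert.

(** The mean is taken after summing over t, so that a single choice of signs serves every t; these
    signs can then enter one argument of a form. *)
Lemma khinchine {I A} (LI : list I) (L : list A) n (v : I -> nat -> A -> R) :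
  exists e, is_sign e /\
    lsum LI (fun t => sqrt (lsum (seq 0 n) (fun i => nsq L (v t i))))
    <= 2 * lsum LI (fun t => sqrt (nsq L (rsum n (v t) e))).
Proof.
  destruct (sign_mean_attained n (fun e => lsum LI (fun t => sqrt (nsq L (rsum n (v t) e)))))
    as (e & he & h).
  exists e; split; auto. rewrite sign_mean_lsum in h.
  apply Rle_trans with (2 * lsum LI (fun t => sign_mean n (fun e => sqrt (nsq L (rsum n (v t) e))))).
  - rewrite <- lsum_scal. apply lsum_le; intros; apply khinchine_mean.
  - lra.
Qed.

(** * Multilinear forms *)

Fixpoint setn (s i : nat) (l : list nat) : list nat :=
  match l, s with
  | nil, _ => nil
  | _ :: l', O => i :: l'
  | x :: l', S s' => x :: setn s' i l'
  end.

Lemma crd_setn s i l j : (s < length l)%nat ->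
  crd (setn s i l) j = if Nat.eqb j s then i else crd l j.
Proof.
  unfold crd. revert s j; induction l as [|x l IH]; intros s j h; [simpl in h; lia|].
  destruct s, j; simpl; auto. apply IH. simpl in h; lia.
Qed.

(** Each tuple arises n times, once for each value that was overwritten. A slot can thus be summed
    out without changing the index set, at the price of a factor n. *)
Lemma lsum_tuples_setn n m s F : (s < m)%nat ->
  lsum (tuples n m) (fun l => lsum (seq 0 n) (fun i => F (setn s i l))) = INR n * lsum (tuples n m) F.
Proof.
  revert s F; induction m as [|m IH]; intros s F h; [lia|].
  rewrite !lsum_tuples_S. destruct s as [|s]; simpl.
  - rewrite lsum_const, length_seq. f_equal. rewrite lsum_swap. reflexivity.
  - rewrite <- lsum_scal. apply lsum_ext; intros i0 _.
    apply (IH s (fun l => F (i0 :: l))). lia.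
Qed.

Lemma Cabs_nonneg z : 0 <= Cabs z.
Proof. apply sqrt_pos. Qed.

Lemma Cabs_sq z : Cabs z * Cabs z = fst z * fst z + snd z * snd z.
Proof. apply sqrt_sqrt. nra. Qed.

Lemma Cabs_mul z w : Cabs (Cmul z w) = Cabs z * Cabs w.
Proof.
  unfold Cabs. rewrite <- sqrt_mult by nra. f_equal. simpl. ring.
Qed.

Lemma Cabs_real x : Cabs (x, 0) = Rabs x.
Proof. unfold Cabs; simpl. rewrite Rmult_0_l, Rplus_0_r. apply sqrt_Rsqr_abs. Qed.

Definition csum (n : nat) (f : nat -> Cx) : Cx :=
  (lsum (seq 0 n) (fun i => fst (f i)), lsum (seq 0 n) (fun i => snd (f i))).

Lemma csum_ext n f g : (forall i, (i < n)%nat -> f i = g i) -> csum n f = csum n g.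
Proof.
  intros h. unfold csum. f_equal; apply lsum_ext; intros i hi%in_seq; rewrite h; auto; lia.
Qed.

Lemma csum_S n f : csum (S n) f = Cadd (csum n f) (f n).
Proof. unfold csum, Cadd. now rewrite !lsum_seq_S. Qed.

Lemma inK_csum K n f : (forall i, (i < n)%nat -> inK K (f i)) -> inK K (csum n f).
Proof.
  destruct K; simpl; auto. intros h. rewrite (lsum_ext _ _ (fun _ => 0)), lsum_const; [ring|].
  intros i hi%in_seq; apply h; lia.
Qed.

Lemma inK_Cmul K z w : inK K z -> inK K w -> inK K (Cmul z w).
Proof. destruct K; simpl; auto. intros -> ->. ring. Qed.

Lemma inK_real K x : inK K (x, 0).
Proof. destruct K; simpl; auto. Qed.

Definition cv (w : nat -> R) : nat -> Cx := fun i => (w i, 0).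
Definition dl (i0 : nat) (w : nat -> R) : nat -> R := fun i => if Nat.eqb i i0 then w i else 0.

Section Form.
Variables (K : field_kind) (m n : nat) (T : (nat -> nat -> Cx) -> Cx).
Hypothesis hT : is_multilinear K m n T.

Lemma form_ext x y : (forall j i, (j < m)%nat -> (i < n)%nat -> x j i = y j i) -> T x = T y.
Proof. apply hT. Qed.

Lemma form_csum N x k (c : nat -> Cx) (v : nat -> nat -> Cx) :
  (k < m)%nat -> admissible K m n x -> (forall i, (i < N)%nat -> inK K (c i)) ->
  (forall i i', (i < N)%nat -> (i' < n)%nat -> inK K (v i i')) ->
  T (upd x k (fun i' => csum N (fun i => Cmul (c i) (v i i'))))
  = csum N (fun i => Cmul (c i) (T (upd x k (v i)))).
Proof.
  destruct hT as (_ & _ & hlin). intros hk hx hc hv.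
  induction N as [|N IH].
  - unfold csum; simpl.
    (* The empty combination: linearity with a = 1 and u = v = 0 gives T(0) = T(0) + T(0). *)
    assert (h := hlin x k Defs.C1 (fun _ => (0, 0)) (fun _ => (0, 0)) hk hx (inK_real K 1)
       (fun _ _ => inK_real K 0) (fun _ _ => inK_real K 0)).
    rewrite (form_ext _ (upd x k (fun _ => (0, 0)))) in h
      by (intros j i _ _; unfold upd; destruct (Nat.eqb j k); auto;
          unfold Cadd, Cmul, Defs.C1; simpl; f_equal; ring).
    change (T (upd x k (fun _ => (0, 0))) = (0, 0)).
    destruct (T (upd x k (fun _ => (0, 0)))) as [a b].
    assert (h1 := f_equal fst h). assert (h2 := f_equal snd h).
    unfold Cadd, Cmul, Defs.C1 in h1, h2; simpl in h1, h2. f_equal; lra.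
  - rewrite csum_S, <- IH; auto.
    rewrite <- (form_ext (upd x k (fun i' =>
       Cadd (Cmul (c N) (v N i')) (csum N (fun i => Cmul (c i) (v i i')))))).
    + rewrite hlin; auto.
      * unfold Cadd; f_equal; apply Rplus_comm.
      * intros i' hi'. apply inK_csum; intros i hi. apply inK_Cmul; auto.
    + intros j i _ _. unfold upd. destruct (Nat.eqb j k); auto.
      rewrite csum_S. unfold Cadd; f_equal; apply Rplus_comm.
Qed.

Lemma form_scal x k (c : R) (v : nat -> R) : (k < m)%nat -> admissible K m n x ->
  T (upd x k (cv (fun i => c * v i))) = Cmul (c, 0) (T (upd x k (cv v))).
Proof.
  intros hk hx.
  assert (h := form_csum 1 x k (fun _ => (c, 0)) (fun _ => cv v) hk hx
     (fun _ _ => inK_real K c) (fun _ _ _ _ => inK_real K _)).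
  rewrite csum_S in h. unfold csum at 2 in h. simpl in h.
  rewrite (form_ext _ (upd x k (fun i' => csum 1 (fun _ => Cmul (c, 0) (cv v i'))))).
  - rewrite h. unfold Cadd, Cmul; simpl; f_equal; ring.
  - intros j i _ _. unfold upd. destruct (Nat.eqb j k); auto.
    unfold csum, Cmul, cv; simpl; f_equal; ring.
Qed.

Lemma form_prod (c : nat -> R) (v : nat -> nat -> R) :
  T (fun j => cv (fun i => c j * v j i)) = Cmul (lprod (seq 0 m) c, 0) (T (fun j => cv (v j))).
Proof.
  (* The scalars are extracted one slot at a time; only the slots below s are scaled. *)
  assert (h : forall s, (s <= m)%nat ->
    T (fun j => if Nat.ltb j s then cv (fun i => c j * v j i) else cv (v j))
    = Cmul (lprod (seq 0 s) c, 0) (T (fun j => cv (v j)))).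
  { induction s as [|s IH]; intros hs.
    - simpl. unfold Cmul; simpl. rewrite !Rmult_0_l, !Rmult_1_l, Rminus_0_r, Rplus_0_r.
      now destruct (T _).
    - set (x := fun j => if Nat.ltb j s then cv (fun i => c j * v j i) else cv (v j)).
      assert (hx : admissible K m n x).
      { intros j i _ _; unfold x. destruct (Nat.ltb j s); apply inK_real. }
      rewrite (form_ext _ (upd x s (cv (fun i => c s * v s i)))).
      + rewrite form_scal by (auto; lia).
        rewrite (form_ext (upd x s (cv (v s))) x).
        * unfold x; rewrite IH by lia. rewrite seq_S.
          replace (lprod (seq 0 s ++ [(0 + s)%nat]) c) with (c s * lprod (seq 0 s) c).
          -- unfold Cmul; simpl; f_equal; ring.
          -- simpl. clear. generalize (seq 0 s). induction l; simpl; [ring|rewrite <- IHl; ring].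
        * intros j i _ _. unfold upd, x. destruct (Nat.eqb_spec j s); subst; auto.
          now rewrite Nat.ltb_irrefl.
      + intros j i _ _. unfold upd, x. destruct (Nat.eqb_spec j s) as [->|hj].
        * now rewrite (proj2 (Nat.ltb_lt s (S s))) by lia.
        * destruct (Nat.ltb_spec j (S s)), (Nat.ltb_spec j s); auto; lia. }
  rewrite <- h by lia. apply form_ext. intros j i hj _.
  now rewrite (proj2 (Nat.ltb_lt j m) hj).
Qed.

Lemma form_signed x k (e w : nat -> R) : (k < m)%nat -> admissible K m n x ->
  T (upd x k (cv (fun i => e i * w i)))
  = csum n (fun i => Cmul (e i, 0) (T (upd x k (cv (dl i w))))).
Proof.
  intros hk hx. rewrite <- form_csum; auto; try (intros; apply inK_real).
  apply form_ext; intros j i _ hi. unfold upd. destruct (Nat.eqb j k); auto.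
  unfold csum, cv, Cmul, dl; simpl. f_equal.
  - rewrite (lsum_ext _ _ (fun i0 => if Nat.eqb i0 i then e i0 * w i else 0)).
    + now rewrite (lsum_seq_single n i (fun i0 => e i0 * w i)).
    + intros i0 _. rewrite (Nat.eqb_sym i). destruct (Nat.eqb i0 i); ring.
  - rewrite (lsum_ext _ _ (fun _ => 0)), lsum_const; [ring|].
    intros i0 _. ring.
Qed.

Definition phase (z : Cx) : Cx :=
  if Req_EM_T (Cabs z) 0 then Defs.C1 else (fst z / Cabs z, - snd z / Cabs z).

Lemma phase_mul z : Cmul (phase z) z = (Cabs z, 0).
Proof.
  unfold phase. assert (h := Cabs_sq z). destruct (Req_EM_T (Cabs z) 0) as [h0|h0].
  - rewrite h0 in *. unfold Cmul, Defs.C1; simpl. f_equal; nra.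
  - unfold Cmul; simpl. f_equal; [|field; auto].
    replace (fst z / Cabs z * fst z - - snd z / Cabs z * snd z)
      with ((fst z * fst z + snd z * snd z) / Cabs z) by (field; auto).
    rewrite <- h. field; auto.
Qed.

Lemma phase_abs z : Cabs (phase z) = 1.
Proof.
  unfold phase. destruct (Req_EM_T (Cabs z) 0) as [h0|h0].
  - unfold Defs.C1. rewrite Cabs_real. apply Rabs_R1.
  - assert (h := Cabs_sq z). unfold Cabs at 1; simpl.
    replace (fst z / Cabs z * (fst z / Cabs z) + - snd z / Cabs z * (- snd z / Cabs z))
      with ((fst z * fst z + snd z * snd z) / (Cabs z * Cabs z)) by (field; auto).
    rewrite <- h. replace (_ / _) with 1 by (field; auto). apply sqrt_1.
Qed.

Lemma phase_inK z : inK K z -> inK K (phase z).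
Proof.
  unfold phase. destruct K; simpl; auto. intros h.
  destruct (Req_EM_T (Cabs z) 0); simpl; auto. rewrite h. unfold Rdiv; ring.
Qed.

(** Rotating the entries of w aligns all terms of the expansion along slot k, so their l_1 sum
    becomes a single value of the form. Moduli are preserved, and for real forms the rotations are
    signs. *)
Lemma form_phase x k (w : nat -> R) : (k < m)%nat -> admissible K m n x ->
  exists y, (forall i, (i < n)%nat -> inK K (y i) /\ Cabs (y i) = Rabs (w i)) /\
    Cabs (T (upd x k y)) = lsum (seq 0 n) (fun i => Cabs (T (upd x k (cv (dl i w))))).
Proof.
  intros hk hx.
  pose (c := fun i => phase (T (upd x k (cv (dl i w))))).
  assert (hc : forall i, inK K (c i)).
  { intros i. apply phase_inK. apply hT. intros j i' hj hi'. unfold upd.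
    destruct (Nat.eqb j k); [apply inK_real|auto]. }
  exists (fun i => Cmul (c i) (w i, 0)). split.
  - intros i hi. split; [apply inK_Cmul; auto; apply inK_real|].
    rewrite Cabs_mul, Cabs_real. unfold c; rewrite phase_abs; ring.
  - rewrite (form_ext _ (upd x k (fun i' => csum n (fun i => Cmul (c i) (cv (dl i w) i'))))).
    + rewrite form_csum; auto; try (intros; apply inK_real).
      rewrite (csum_ext _ _ (fun i => (Cabs (T (upd x k (cv (dl i w)))), 0))).
      * unfold csum; simpl. rewrite (lsum_const _ 0), Rmult_0_r, Cabs_real, Rabs_right; auto.
        apply Rle_ge, lsum_nonneg; intros; apply Cabs_nonneg.
      * intros i _. apply phase_mul.
    + intros j i _ hi. unfold upd. destruct (Nat.eqb j k); auto.
      unfold csum, Cmul, cv, dl; simpl. f_equal; symmetry.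
      * rewrite (lsum_ext _ _ (fun i0 => if Nat.eqb i0 i then fst (c i0) * w i - snd (c i0) * 0 else 0)).
        -- now rewrite (lsum_seq_single n i (fun i0 => fst (c i0) * w i - snd (c i0) * 0)).
        -- intros i0 _. rewrite (Nat.eqb_sym i). destruct (Nat.eqb i0 i); ring.
      * rewrite (lsum_ext _ _ (fun i0 => if Nat.eqb i0 i then fst (c i0) * 0 + snd (c i0) * w i else 0)).
        -- now rewrite (lsum_seq_single n i (fun i0 => fst (c i0) * 0 + snd (c i0) * w i)).
        -- intros i0 _. rewrite (Nat.eqb_sym i). destruct (Nat.eqb i0 i); ring.
Qed.
End Form.

(** * Weighted bounds for the coefficients of a form *)

Lemma lsum_tuples_one n m : lsum (tuples n m) (fun _ => 1) = INR n ^ m.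
Proof.
  induction m; [simpl; ring|]. rewrite lsum_tuples_S, lsum_const, length_seq, IHm. simpl; ring.
Qed.

Lemma fib_tuples_one n m k t : (k < m)%nat -> (t < n)%nat ->
  fib (tuples n m) k t (fun _ => 1) = INR n ^ (m - 1).
Proof.
  intros hk ht. assert (hn : 0 < INR n) by (apply lt_0_INR; lia).
  apply Rmult_eq_reg_l with (INR n); [|lra].
  unfold fib. rewrite <- (lsum_tuples_setn n m k) by auto.
  replace (INR n * INR n ^ (m - 1)) with (INR n ^ m)
    by (rewrite tech_pow_Rmult; f_equal; lia).
  rewrite <- lsum_tuples_one. apply lsum_ext; intros l [hl _]%in_tuples.
  rewrite (lsum_ext _ _ (fun i => if Nat.eqb i t then 1 else 0)).
  - now rewrite (lsum_seq_single n t (fun _ => 1)).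
  - intros i _. rewrite crd_setn, Nat.eqb_refl by lia. reflexivity.
Qed.

Lemma sqrt_pow_nat a c : 0 <= a -> sqrt (a ^ c) = sqrt a ^ c.
Proof.
  intros ha; induction c; simpl; [apply sqrt_1|]. rewrite sqrt_mult, IHc; auto. now apply pow_le.
Qed.

Section Weighted.
Variables (K : field_kind) (m n : nat) (T : (nat -> nat -> Cx) -> Cx).
Hypothesis hT : is_multilinear K m n T.
Variables (x : nat -> nat -> R) (k : nat).
Hypothesis hk : (k < m)%nat.
Hypothesis hn : (1 <= n)%nat.

(* Slots j < s other than k carry the randomised vector e_j x_j, the other ones the vector
   x_j(l_j) e_{l_j}. *)
Definition mixed_args (e : nat -> nat -> R) (s : nat) (l : list nat) : nat -> nat -> Cx :=
  fun j => if andb (Nat.ltb j s) (negb (Nat.eqb j k)) then cv (fun i => e j i * x j i)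
           else cv (dl (crd l j) (x j)).

(** A randomised slot no longer depends on its coordinate of l, yet that coordinate is still summed
    over. This redundancy produces the factors sqrt(n) below, which cancel at the end. *)
Definition mixed_fib (e : nat -> nat -> R) (s t : nat) : R :=
  fib (tuples n m) k t (fun l => Cabs (T (mixed_args e s l)) * Cabs (T (mixed_args e s l))).

Lemma mixed_fib_nonneg e s t : 0 <= mixed_fib e s t.
Proof. apply fib_nonneg; intros; apply Rle_0_sqr. Qed.

Lemma admissible_mixed_args e s l : admissible K m n (mixed_args e s l).
Proof. intros j i _ _. unfold mixed_args. destruct andb; apply inK_real. Qed.

Definition part (b : bool) (z : Cx) : R := if b then fst z else snd z.

(** Khinchine's inequality in slot s. The Hilbert space is indexed by tuples together with a choice
    of real or imaginary part, because |z|^2 is the sum of two real squares. *)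
Lemma mixed_step e s : (s < m)%nat -> s <> k -> exists w, is_sign w /\
  sqrt (INR n) * lsum (seq 0 n) (fun t => sqrt (mixed_fib e s t))
  <= 2 * lsum (seq 0 n) (fun t => sqrt (mixed_fib (upd e s w) (S s) t)).
Proof.
  intros hs hsk.
  pose (LA := flat_map (fun l => [(l, true); (l, false)]) (tuples n m)).
  pose (v := fun t i (a : list nat * bool) => if Nat.eqb (crd (fst a) k) t then
     part (snd a) (T (upd (mixed_args e s (fst a)) s (cv (dl i (x s))))) else 0).
  destruct (khinchine (seq 0 n) LA n v) as (w & hw & h).
  exists w; split; auto.
  rewrite (lsum_ext _ (fun t => sqrt (lsum _ _)) (fun t => sqrt (INR n) * sqrt (mixed_fib e s t))),
    lsum_scal, (lsum_ext _ (fun t => sqrt (nsq _ _)) (fun t => sqrt (mixed_fib (upd e s w) (S s) t))) in h.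
  - exact h.
  - intros t _. f_equal. unfold nsq, mixed_fib, fib, LA. rewrite lsum_flat_map.
    apply lsum_ext; intros l _. simpl. unfold rsum, v; simpl.
    destruct (Nat.eqb (crd l k) t).
    2:{ rewrite !(lsum_ext _ (fun i => w i * 0) (fun _ => 0)), !lsum_const by (intros; ring). ring. }
    rewrite <- (form_ext K m n T hT (upd (mixed_args e s l) s (cv (fun i => w i * x s i)))).
    + rewrite Cabs_sq, form_signed with (K := K) (m := m) (n := n) by (auto using admissible_mixed_args).
      unfold csum; simpl.
      rewrite (lsum_ext _ (fun i => w i * fst (T _) - _) (fun i => w i * fst (T (upd (mixed_args e s l) s (cv (dl i (x s)))))))
        by (intros; ring).
      rewrite (lsum_ext _ (fun i => w i * snd (T _) + _) (fun i => w i * snd (T (upd (mixed_args e s l) s (cv (dl i (x s)))))))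
        by (intros; ring). ring.
    + intros j i hj _. unfold upd, mixed_args. destruct (Nat.eqb_spec j s) as [->|hjs].
      * rewrite (proj2 (Nat.ltb_lt s (S s))) by lia.
        destruct (Nat.eqb_spec s k); [tauto|reflexivity].
      * destruct (Nat.ltb_spec j s), (Nat.ltb_spec j (S s)); auto; lia.
  - intros t _. rewrite <- sqrt_mult by (apply pos_INR || apply mixed_fib_nonneg). f_equal.
    unfold mixed_fib, fib. rewrite <- (lsum_tuples_setn n m s) by auto. rewrite lsum_swap.
    apply lsum_ext; intros i hi%in_seq. unfold nsq, LA. rewrite lsum_flat_map.
    apply lsum_ext; intros l [hl _]%in_tuples. simpl. unfold v; simpl.
    rewrite crd_setn by lia. destruct (Nat.eqb_spec k s) as [|_]; [congruence|].
    destruct (Nat.eqb (crd l k) t); [|ring].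
    rewrite (form_ext K m n T hT (mixed_args e s (setn s i l)) (upd (mixed_args e s l) s (cv (dl i (x s))))).
    + rewrite Cabs_sq. simpl. ring.
    + intros j i' hj _. unfold upd, mixed_args. rewrite crd_setn by lia.
      destruct (Nat.eqb_spec j s) as [->|hjs]; auto. now rewrite Nat.ltb_irrefl.
Qed.

(** [c] counts the slots below s other than k, that is, the applications of Khinchine's inequality
    made so far. *)
Lemma mixed_iterate s : (s <= m)%nat -> exists e, (forall j, is_sign (e j)) /\
  let c := (if Nat.ltb k s then s - 1 else s)%nat in
  sqrt (INR n) ^ c * lsum (seq 0 n) (fun t => sqrt (mixed_fib (fun _ _ => 1) 0 t))
  <= 2 ^ c * lsum (seq 0 n) (fun t => sqrt (mixed_fib e s t)).
Proof.
  induction s as [|s IH]; intros hs.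
  - exists (fun _ _ => 1). split; [intros j i; auto|]. simpl. lra.
  - destruct (IH ltac:(lia)) as (e & he & h). clear IH. cbv zeta in *.
    destruct (Nat.eq_dec s k) as [->|hsk].
    + exists e. split; auto.
      rewrite Nat.ltb_irrefl in h. rewrite (proj2 (Nat.ltb_lt k (S k))) by lia.
      replace (S k - 1)%nat with k by lia.
      rewrite (lsum_ext _ (fun t => sqrt (mixed_fib e (S k) t)) (fun t => sqrt (mixed_fib e k t))); auto.
      intros t _. f_equal. unfold mixed_fib. apply fib_ext; intros l _ _.
      rewrite (form_ext K m n T hT (mixed_args e (S k) l) (mixed_args e k l)); auto.
      intros j i _ _. unfold mixed_args.
      destruct (Nat.eqb_spec j k); [now rewrite !Bool.andb_false_r|].
      destruct (Nat.ltb_spec j k), (Nat.ltb_spec j (S k)); auto; lia.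
    + destruct (mixed_step e s ltac:(lia) hsk) as (w & hw & hstep).
      exists (upd e s w). split.
      { intros j. unfold upd. destruct (Nat.eqb j s); auto. }
      set (c := (if Nat.ltb k s then s - 1 else s)%nat) in h.
      replace (if Nat.ltb k (S s) then S s - 1 else S s)%nat with (S c)
        by (unfold c; destruct (Nat.ltb_spec k s), (Nat.ltb_spec k (S s)); lia).
      simpl. set (S0 := lsum _ (fun t => sqrt (mixed_fib (fun _ _ => 1) 0 t))) in *.
      set (S1 := lsum _ (fun t => sqrt (mixed_fib e s t))) in *.
      set (S2 := lsum _ (fun t => sqrt (mixed_fib (upd e s w) (S s) t))) in *.
      assert (h2 : 0 < 2 ^ c) by (apply pow_lt; lra).
      assert (h3 := sqrt_pos (INR n)).
      apply Rle_trans with (sqrt (INR n) * (2 ^ c * S1)).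
      * rewrite Rmult_assoc. apply Rmult_le_compat_l; auto.
      * replace (sqrt (INR n) * (2 ^ c * S1)) with (2 ^ c * (sqrt (INR n) * S1)) by ring.
        replace (2 * 2 ^ c * S2) with (2 ^ c * (2 * S2)) by ring.
        apply Rmult_le_compat_l; lra.
Qed.

(** Once all slots but k are randomised, the t-th marginal consists of n^(m-1) copies of one number,
    and the choice of phases in slot k turns the sum over t into a single value of T. The argument
    of that value has moduli x_j(i), hence the form of the hypothesis on B; each of the m - 1
    randomised slots contributes a factor 2. *)
Lemma weighted_coef_bound (B : R) :
  (forall j i, 0 <= x j i) ->
  (forall y, admissible K m n y -> (forall j i, (j < m)%nat -> (i < n)%nat -> Cabs (y j i) = x j i) ->
     Cabs (T y) <= B) ->
  lsum (seq 0 n) (fun t => sqrt (fib (tuples n m) k t (fun l =>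
    Cabs (T (fun j => cv (dl (crd l j) (x j)))) * Cabs (T (fun j => cv (dl (crd l j) (x j)))))))
  <= 2 ^ (m - 1) * B.
Proof.
  intros hx hB.
  assert (hn' : 0 < INR n) by (apply lt_0_INR; lia).
  destruct (mixed_iterate m (le_n m)) as (e & he & h). cbv zeta in h.
  rewrite (proj2 (Nat.ltb_lt k m) hk) in h.
  change (lsum (seq 0 n) (fun t => sqrt (mixed_fib (fun _ _ => 1) 0 t)) <= 2 ^ (m - 1) * B).
  set (S0 := lsum _ (fun t => sqrt (mixed_fib (fun _ _ => 1) 0 t))) in *.
  pose (y := fun j => cv (fun i => e j i * x j i)).
  assert (hy : admissible K m n y) by (intros j i _ _; apply inK_real).
  destruct (form_phase K m n T hT y k (x k) hk hy) as (z & hz & hzT).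
  assert (hcn : 0 < sqrt (INR n) ^ (m - 1)) by (apply pow_lt, sqrt_lt_R0; auto).
  rewrite (lsum_ext _ (fun t => sqrt (mixed_fib e m t))
    (fun t => sqrt (INR n) ^ (m - 1) * Cabs (T (upd y k (cv (dl t (x k))))))) in h.
  - rewrite lsum_scal, <- hzT in h.
    apply Rmult_le_reg_l with (sqrt (INR n) ^ (m - 1)); auto.
    eapply Rle_trans; [exact h|].
    replace (2 ^ (m - 1) * (sqrt (INR n) ^ (m - 1) * Cabs (T (upd y k z))))
      with (sqrt (INR n) ^ (m - 1) * (2 ^ (m - 1) * Cabs (T (upd y k z)))) by ring.
    apply Rmult_le_compat_l; [lra|]. apply Rmult_le_compat_l; [apply pow_le; lra|].
    apply hB.
    + intros j i hj hi. unfold upd. destruct (Nat.eqb j k); [apply hz; auto|apply hy; auto].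
    + intros j i hj hi. unfold upd. destruct (Nat.eqb_spec j k) as [->|_].
      * rewrite (proj2 (hz i hi)). apply Rabs_right, Rle_ge; auto.
      * unfold y, cv. rewrite Cabs_real, Rabs_mult, (Rabs_right (x j i)) by (apply Rle_ge; auto).
        destruct (he j i) as [-> | ->]; unfold Rabs; destruct Rcase_abs; lra.
  - intros t ht%in_seq. unfold mixed_fib.
    set (z0 := Cabs (T (upd y k (cv (dl t (x k)))))).
    rewrite (fib_ext _ _ _ _ (fun l => 1 * (z0 * z0))).
    + rewrite (fib_scal_r _ _ _ (fun _ => 1)), fib_tuples_one by (auto; lia).
      rewrite sqrt_mult, sqrt_pow_nat, sqrt_square; try lra; try apply Cabs_nonneg; try apply Rle_0_sqr.
      apply pow_le; lra.
    + intros l _ hl. rewrite Rmult_1_l. unfold z0.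
      rewrite (form_ext K m n T hT (mixed_args e m l) (upd y k (cv (dl t (x k))))); auto.
      intros j i hj _. unfold mixed_args, upd, y. rewrite (proj2 (Nat.ltb_lt j m) hj).
      destruct (Nat.eqb_spec j k) as [->|]; simpl; auto. now rewrite hl.
Qed.
End Weighted.

(** * Unit balls and the weighted bound of a form *)

Definition coef (T : (nat -> nat -> Cx) -> Cx) (l : list nat) : R := coefabs T (fun j => crd l j).

Lemma unitv_cv i : unitv i = cv (fun l => if Nat.eqb l i then 1 else 0).
Proof.
  apply functional_extensionality; intros l.
  unfold unitv, cv. destruct (Nat.eqb l i); reflexivity.
Qed.

Lemma fmax_le n f c : 0 <= c -> (forall i, (i < n)%nat -> f i <= c) -> fmax n f <= c.
Proof.
  intros hc; induction n; intros h; simpl; auto. apply Rmax_lub; auto.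
Qed.

Lemma lp_norm_le_1 q n (v : nat -> Cx) (w : nat -> R) : ext_ge1 q ->
  (forall i, (i < n)%nat -> Cabs (v i) = w i) -> in_ball (ext_inv q) n w -> lp_norm q n v <= 1.
Proof.
  intros hq hv hw. unfold in_ball in hw. destruct q as [a|]; simpl in *.
  - assert (0 < / a) by (apply Rinv_0_lt_compat; lra).
    destruct (Req_EM_T (/ a) 0); [lra|]. rewrite Rinv_inv in hw.
    apply rpow_le_1; [|lra]. rewrite fsum_lsum. split.
    + apply lsum_nonneg; intros; apply rpow_nonneg.
    + rewrite (lsum_ext _ _ (fun i => rpow (w i) a)); auto. intros i hi%in_seq. rewrite hv; auto; lia.
  - destruct (Req_EM_T 0 0); [|lra]. apply fmax_le; [lra|]. intros i hi. rewrite hv; auto.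
Qed.

(** This value shows that the set is not empty and that its upper bounds are nonnegative. *)
Lemma zero_in_norm_set K m n p T : (forall j, (j < m)%nat -> ext_ge1 (p j)) ->
  norm_set K m n p T (Cabs (T (fun j => cv (fun _ => 0)))).
Proof.
  intros hp. eexists; split; [|split; [|reflexivity]]; [intros j i _ _; apply inK_real|].
  intros j hj. apply lp_norm_le_1 with (fun _ => 0); auto.
  - intros i _. unfold cv. rewrite Cabs_real. apply Rabs_R0.
  - unfold in_ball. destruct (Req_EM_T _ 0); [intros; lra|].
    rewrite (lsum_ext _ _ (fun _ => 0)), lsum_const; [lra|]. intros; apply rpow_zero.
Qed.

Lemma lp_norm_coord q n (v : nat -> Cx) i : ext_ge1 q -> (i < n)%nat -> lp_norm q n v <= 1 ->
  Cabs (v i) <= 1.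
Proof.
  intros hq hi hv. destruct q as [a|]; simpl in *.
  - assert (hia : 0 < / a) by (apply Rinv_0_lt_compat; lra).
    apply Rle_trans with (2 := hv). rewrite fsum_lsum.
    apply rpow_le_inv with a; try apply rpow_nonneg; try apply Cabs_nonneg; try lra.
    rewrite rpow_inv_cancel' by (try lra; apply lsum_nonneg; intros; apply rpow_nonneg).
    apply (lsum_term_le _ (fun i => rpow (Cabs (v i)) a)); [intros; apply rpow_nonneg|].
    apply in_seq; lia.
  - apply Rle_trans with (2 := hv). clear hv. induction n; [lia|]. simpl.
    destruct (Nat.eq_dec i n) as [e|]; [subst; apply Rmax_r|].
    eapply Rle_trans; [|apply Rmax_l]. apply IHn; lia.
Qed.

Lemma coef_weighted_bound K m n p T normT : (1 <= n)%nat -> is_multilinear K m n T ->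
  (forall j, (j < m)%nat -> ext_ge1 (p j)) -> is_lub (norm_set K m n p T) normT ->
  weighted_bound m n (tuples n m) (fun l => rpow (coef T l) 2) (fun j => ext_inv (p j))
    (2 ^ (m - 1) * normT).
Proof.
  intros hn hT hp hN x hx hb k hk.
  eapply Rle_trans; [|apply (weighted_coef_bound K m n T hT x k hk hn normT hx)].
  - apply Req_le, lsum_ext; intros t _.
    rewrite rpow_sqrt by (apply fib_nonneg; intros; apply Rmult_le_pos; [apply rpow_nonneg|];
      apply lprod_nonneg; intros; apply rpow_nonneg).
    f_equal. apply fib_ext; intros l hl _.
    rewrite rpow_2_r by apply Cabs_nonneg.
    rewrite <- lprod_rpow, rpow_2_r by (auto; apply lprod_nonneg; auto).
    set (P := lprod (seq 0 m) (fun j => x j (crd l j))).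
    assert (hP : 0 <= P) by (apply lprod_nonneg; auto).
    rewrite <- (form_ext K m n T hT (fun j => cv (fun i => x j (crd l j) * (if Nat.eqb i (crd l j) then 1 else 0)))).
    + rewrite (form_prod K m n T hT (fun j => x j (crd l j)) (fun j i => if Nat.eqb i (crd l j) then 1 else 0)).
      fold P. rewrite Cabs_mul, Cabs_real, Rabs_right by lra.
      unfold coef, coefabs.
      rewrite (form_ext K m n T hT (fun j => unitv (crd l j)) (fun j => cv (fun i => if Nat.eqb i (crd l j) then 1 else 0)))
        by (intros; now rewrite unitv_cv). ring.
    + intros j i _ _. unfold cv, dl. f_equal. destruct (Nat.eqb_spec i (crd l j)) as [->|]; ring.
  - intros y hy hyx. apply hN. exists y. repeat split; auto.
    intros j hj. apply lp_norm_le_1 with (x j); auto.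
Qed.

(** * The upper bound *)

(** Writes l into the slots k, k + 1, ... in the order in which [mixed_aux] fixes its indices. *)
Fixpoint updl (idx : nat -> nat) (k : nat) (l : list nat) : nat -> nat :=
  match l with nil => idx | i :: l' => updl (upd idx k i) (S k) l' end.

Lemma updl_spec idx k l j :
  updl idx k l j = if andb (Nat.leb k j) (Nat.ltb j (k + length l)) then crd l (j - k) else idx j.
Proof.
  revert idx k; induction l as [|i l IH]; intros idx k; simpl.
  - destruct (Nat.leb_spec k j), (Nat.ltb_spec j (k + 0)); auto; lia.
  - rewrite IH. unfold upd, crd.
    destruct (Nat.leb_spec (S k) j), (Nat.ltb_spec j (S k + length l)),
      (Nat.leb_spec k j), (Nat.ltb_spec j (k + S (length l))), (Nat.eqb_spec j k); simpl; auto; try lia.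
    + replace (j - k)%nat with (S (j - S k)) by lia. reflexivity.
    + subst. now rewrite Nat.sub_diag.
Qed.

(** At depth d, [mixed_aux] is a mixed norm over the last d + 1 slots before its final root; the
    quotient r_k / r_(k+1) merges the root of one level with the power of the next. *)
Lemma mixed_aux_mx m n r T d idx : (d < m)%nat -> (forall j, (j < m)%nat -> 0 < r j) ->
  mixed_aux m n r T d idx = lsum (seq 0 n) (fun i =>
    rpow (mx n d (fun j => r (m - d + j)%nat)
            (fun l => coefabs T (updl (upd idx (m - 1 - d)%nat i) (m - d) l))) (r (m - 1 - d)%nat)).
Proof.
  intros hd hr. revert idx; induction d as [|d IH]; intros idx.
  - simpl. rewrite fsum_lsum, Nat.sub_0_r. apply lsum_ext; intros; reflexivity.
  - cbn [mixed_aux]. rewrite fsum_lsum. apply lsum_ext; intros i _.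
    rewrite IH by lia. cbn [mx]. rewrite rpow_rpow
      by (apply lsum_nonneg; intros; apply rpow_nonneg).
    replace (m - S d + 0)%nat with (m - 1 - d)%nat by lia.
    replace (S (m - 1 - S d)) with (m - 1 - d)%nat by lia.
    replace (r (m - 1 - S d)%nat / r (m - 1 - d)%nat)
      with (/ r (m - 1 - d)%nat * r (m - 1 - S d)%nat) by (unfold Rdiv; ring).
    f_equal. apply lsum_ext; intros i' _. f_equal.
    apply mx_ext.
    + intros j hj. f_equal; lia.
    + intros l _. cbn [updl]. replace (m - S d)%nat with (m - 1 - d)%nat by lia.
      now replace (S (m - 1 - d)) with (m - d)%nat by lia.
Qed.

Lemma mixed_sum_mx K m n r T : (1 <= m)%nat -> is_multilinear K m n T ->
  (forall j, (j < m)%nat -> 0 < r j) -> mixed_sum m n r T = mx n m r (coef T).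
Proof.
  intros hm hT hr. unfold mixed_sum. rewrite mixed_aux_mx by (auto; lia).
  destruct m as [|d]; [lia|].
  replace (S d - 1)%nat with d by lia. replace (S d - 1 - d)%nat with O by lia.
  replace (S d - d)%nat with 1%nat by lia. cbn [mx]. f_equal.
  apply lsum_ext; intros i _. replace (d - d)%nat with O by lia. f_equal.
  apply mx_ext; [intros; reflexivity|].
  intros l [hl _]%in_tuples. unfold coef, coefabs. f_equal.
  apply (form_ext K (S d) n T hT). intros j i' hj _. f_equal.
  change (updl (fun _ => O) 0 (i :: l) j = crd (i :: l) j).
  rewrite updl_spec. rewrite (proj2 (Nat.leb_le 0 j)) by lia.
  rewrite (proj2 (Nat.ltb_lt j _)) by (simpl; lia). simpl. now rewrite Nat.sub_0_r.
Qed.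

Lemma upper_bound K m p r n T normT : (1 <= m)%nat ->
  (forall j, (j < m)%nat -> ext_ge1 (p j)) -> sum_inv m p <= 1 / 2 ->
  (forall j, (j < m)%nat -> 1 <= r j <= 2) ->
  (1 <= n)%nat -> is_multilinear K m n T -> is_lub (norm_set K m n p T) normT ->
  mixed_sum m n r T <= 2 ^ (m - 1)
    * Rpower (INR n) (Rmax (fsum m (fun j => / r j) - (INR m + 1) / 2 + sum_inv m p) 0) * normT.
Proof.
  intros hm hp hpU hr hn hT hN.
  assert (hinv : forall j, (j < m)%nat -> 0 <= ext_inv (p j)).
  { intros j hj. specialize (hp j hj). destruct (p j); simpl in *; [|lra].
    left; apply Rinv_0_lt_compat; lra. }
  set (U := sum_inv m p) in *.
  assert (hU : lsum (seq 0 m) (fun j => ext_inv (p j)) = U) by (unfold U, sum_inv; now rewrite fsum_lsum).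
  assert (hU0 : 0 <= U) by (rewrite <- hU; apply lsum_nonneg; intros j hj%in_seq; apply hinv; lia).
  assert (hnT : 0 <= normT).
  { apply Rle_trans with (Cabs (T (fun j => cv (fun _ => 0)))); [apply Cabs_nonneg|].
    now apply hN, zero_in_norm_set. }
  assert (h2 : 0 < 2 ^ (m - 1)) by (apply pow_lt; lra).
  set (B := 2 ^ (m - 1) * normT). assert (hB : 0 <= B) by (apply Rmult_le_pos; lra).
  assert (hn' : 0 < INR n) by (apply lt_0_INR; lia).
  rewrite (mixed_sum_mx K) by (auto; intros j hj; specialize (hr j hj); lra).
  rewrite <- rpow_Rpower, fsum_lsum by auto.
  replace (2 ^ (m - 1) * rpow (INR n) _ * normT) with
    (rpow (INR n) (Rmax (lsum (seq 0 m) (fun j => / r j) - (INR m + 1) / 2 + U) 0) * B)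
    by (unfold B; ring).
  assert (hc : forall l, 0 <= coef T l) by (intros; apply Cabs_nonneg).
  apply mx_bound; auto; try lra.
  intros k hk.
  (* U <= 1/2 says exactly that the endpoint exponent is at most 2, as Minkowski's inequality
     requires. *)
  assert (hla : 1 <= / (1 - U) <= 2).
  { split.
    - rewrite <- Rinv_1 at 1. apply Rinv_le_contravar; lra.
    - rewrite <- (Rinv_inv 2). apply Rinv_le_contravar; lra. }
  eapply Rle_trans; [apply mx_endpoint; auto|].
  apply rpow_le_inv with (/ (1 - U)); try apply rpow_nonneg; try lra.
  rewrite rpow_inv_cancel' by (try lra; apply lsum_nonneg; intros; apply rpow_nonneg).
  apply (marginal_bound m n (tuples n m) _ (fun j => ext_inv (p j))); auto; try lra.
  - intros l j hl hj. apply in_tuples in hl as [_ hl]; auto.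
  - intros; apply rpow_nonneg.
  - now apply (coef_weighted_bound K).
Qed.

(** * Random signs *)

(** A subgaussian bound with a generous constant. For x^2 <= 1/2, the bounds exp(x) <= 1/(1 - x) and
    exp(-x) <= 1/(1 + x) average to 1/(1 - x^2) <= 1 + 2x^2; otherwise |x| <= 2x^2. *)
Lemma cosh_le_exp_sq x : (exp x + exp (- x)) / 2 <= exp (2 * (x * x)).
Proof.
  assert (small : forall z, z < 1 -> exp z <= / (1 - z)).
  { intros z hz. assert (h := exp_ineq1_le (- z)). rewrite exp_Ropp in h.
    rewrite <- (Rinv_inv (exp z)). apply Rinv_le_contravar; lra. }
  destruct (Rle_dec (x * x) (/ 2)) as [h|h].
  - assert (h1 := small x ltac:(nra)). assert (h2 := small (- x) ltac:(nra)).
    assert (h3 := exp_ineq1_le (2 * (x * x))).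
    assert (hx : x < 1) by nra. assert (hx' : - 1 < x) by nra.
    assert (h4 : (/ (1 - x) + / (1 - - x)) / 2 = / (1 - x * x)) by (field; split; [|split]; nra).
    assert (h5 : / (1 - x * x) <= 1 + 2 * (x * x)).
    { apply Rmult_le_reg_l with (1 - x * x); [lra|]. rewrite Rinv_r by lra.
      assert (0 <= x * x) by nra. nra. }
    lra.
  - assert (mono : forall y, y <= 2 * (x * x) -> exp y <= exp (2 * (x * x))).
    { intros y [hy| ->]; [left; now apply exp_increasing|lra]. }
    assert (h1 := mono x ltac:(nra)). assert (h2 := mono (- x) ltac:(nra)). lra.
Qed.

(* Method of conditional expectations. *)
Lemma exists_signs {A V} (dec : forall x y : A, {x = y} + {x <> y}) (L : list A) (LV : list V)
    (c : V -> A -> R) (w : V -> R) : NoDup L ->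
  exists a : A -> R, (forall l, a l = 1 \/ a l = -1) /\
    lsum LV (fun v => w v * exp (lsum L (fun l => a l * c v l)))
    <= lsum LV (fun v => Rabs (w v) * exp (lsum L (fun l => 2 * (c v l * c v l)))).
Proof.
  revert w; induction L as [|l0 L IH]; intros w hnd.
  - exists (fun _ => 1). split; auto. simpl. apply lsum_le; intros v _.
    rewrite exp_0, !Rmult_1_r. apply Rle_abs.
  - inversion_clear hnd as [|? ? hl0 hL].
    (* The average over the sign at [l0] is absorbed into the weight; one of the two signs then
       gives a sum no larger than the average. *)
    pose (w' := fun v => w v * ((exp (c v l0) + exp (- c v l0)) / 2)).
    destruct (IH w' hL) as (a & ha & h).
    pose (S := fun s => lsum LV (fun v => w v * exp (lsum L (fun l => a l * c v l)) * exp (s * c v l0))).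
    assert (hs : forall s, (s = 1 \/ s = -1) -> exists a' : A -> R,
       (forall l, a' l = 1 \/ a' l = -1) /\
       lsum LV (fun v => w v * exp (lsum (l0 :: L) (fun l => a' l * c v l))) = S s).
    { intros s hs. exists (fun l => if dec l l0 then s else a l). split.
      - intros l. destruct (dec l l0); auto.
      - apply lsum_ext; intros v _. simpl. destruct (dec l0 l0) as [_|]; [|tauto].
        rewrite (lsum_ext L _ (fun l => a l * c v l)).
        + rewrite exp_plus. ring.
        + intros l hl. destruct (dec l l0) as [->|]; tauto. }
    assert (havg : (S 1 + S (-1)) / 2 = lsum LV (fun v => w' v * exp (lsum L (fun l => a l * c v l)))).
    { unfold S, Rdiv. rewrite <- lsum_plus, <- lsum_scal_r. apply lsum_ext; intros v _.
      unfold w'. replace (-1 * c v l0) with (- c v l0) by ring. rewrite Rmult_1_l. field. }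
    assert (hfin : lsum LV (fun v => Rabs (w' v) * exp (lsum L (fun l => 2 * (c v l * c v l))))
       <= lsum LV (fun v => Rabs (w v) * exp (lsum (l0 :: L) (fun l => 2 * (c v l * c v l))))).
    { apply lsum_le; intros v _. simpl. rewrite exp_plus. unfold w'. rewrite Rabs_mult, Rmult_assoc.
      apply Rmult_le_compat_l; [apply Rabs_pos|]. apply Rmult_le_compat_r; [left; apply exp_pos|].
      assert (h1 := exp_pos (c v l0)). assert (h2 := exp_pos (- c v l0)).
      rewrite Rabs_right by lra. apply cosh_le_exp_sq. }
    destruct (Rle_dec (S 1) (S (-1))).
    + destruct (hs 1) as (a' & h1 & h2); auto. exists a'; split; auto. lra.
    + destruct (hs (-1)) as (a' & h1 & h2); auto. exists a'; split; auto. lra.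
Qed.

Definition trit (c : nat) : R := match c with O => 0 | 1%nat => 1 | _ => -1 end.
Definition is_trit (x : R) : Prop := x = 0 \/ x = 1 \/ x = -1.
(** Families of m vectors with entries in {-1, 0, 1} are coded row by row as words of length n m
    over three letters, so that 3^(n m) test families can be summed over as a list. *)
Definition decode (n : nat) (c : list nat) (j i : nat) : R := trit (crd c (j * n + i)).

Lemma decode_surj n m (v : nat -> nat -> R) : (forall j i, is_trit (v j i)) ->
  exists c, In c (tuples 3 (n * m)) /\
    forall j i, (j < m)%nat -> (i < n)%nat -> decode n c j i = v j i.
Proof.
  intros hv.
  pose (enc := fun x : R => if Req_EM_T x 0 then O else if Req_EM_T x 1 then 1%nat else 2%nat).
  assert (henc : forall x, is_trit x -> trit (enc x) = x).
  { intros x hx. unfold enc, is_trit in *.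
    destruct (Req_EM_T x 0); [simpl; auto|]. destruct (Req_EM_T x 1); simpl; [auto|].
    destruct hx as [h|[h|h]]; lra. }
  pose (F := fun t => enc (v (t / n)%nat (t mod n)%nat)).
  assert (hF : forall t, (t < n * m)%nat -> crd (map F (seq 0 (n * m))) t = F t).
  { intros t ht. unfold crd. rewrite (nth_indep _ O (F O)) by (rewrite length_map, length_seq; auto).
    rewrite map_nth, seq_nth; auto. }
  exists (map F (seq 0 (n * m))). split.
  - apply in_tuples. rewrite length_map, length_seq. split; auto.
    intros j hj. rewrite hF by auto. unfold F, enc.
    destruct (Req_EM_T _ 0); [lia|]. destruct (Req_EM_T _ 1); lia.
  - intros j i hj hi. unfold decode. rewrite hF by nia. unfold F.
    rewrite Nat.div_add_l, Nat.div_small, Nat.add_0_r by lia.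
    rewrite Nat.add_comm, Nat.Div0.mod_add, Nat.mod_small by lia. auto.
Qed.

Lemma lprod_map {A B} (L : list A) (h : A -> B) (f : B -> R) :
  lprod (map h L) f = lprod L (fun x => f (h x)).
Proof. induction L; simpl; congruence. Qed.

Lemma lsum_tuples_prod n m (f : nat -> nat -> R) :
  lsum (tuples n m) (fun l => lprod (seq 0 m) (fun j => f j (crd l j)))
  = lprod (seq 0 m) (fun j => lsum (seq 0 n) (f j)).
Proof.
  revert f; induction m as [|m IH]; intros f; [simpl; ring|].
  rewrite lsum_tuples_S. simpl. rewrite <- seq_shift, lprod_map, <- (IH (fun j => f (S j))).
  rewrite <- lsum_scal_r. apply lsum_ext; intros i _. rewrite <- lsum_scal.
  apply lsum_ext; intros l _. rewrite lprod_map. reflexivity.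
Qed.

Definition real_form (n m : nat) (a : list nat -> R) (v : nat -> nat -> R) : R :=
  lsum (tuples n m) (fun l => a l * lprod (seq 0 m) (fun j => v j (crd l j))).

Definition sq_norm (n : nat) (v : nat -> R) : R := lsum (seq 0 n) (fun i => v i * v i).

Lemma sq_norm_nonneg n v : 0 <= sq_norm n v.
Proof. apply lsum_nonneg; intros; apply Rle_0_sqr. Qed.

Lemma pow3_le_exp k : 3 ^ k <= exp (2 * INR k).
Proof.
  induction k; [simpl; rewrite Rmult_0_r, exp_0; lra|].
  rewrite S_INR. replace (2 * (INR k + 1)) with (2 + 2 * INR k) by ring. rewrite exp_plus. simpl.
  assert (h := exp_ineq1_le 2). assert (0 < 3 ^ k) by (apply pow_lt; lra).
  apply Rmult_le_compat; lra.
Qed.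

(** Scaling by rn / sg v makes the squared coefficients add up to n, and the weights exp(-2n) make
    each term of the averaged bound equal to 1. With 3^(n m) <= exp(2nm) test families, every
    exponent -2n + (rn / sg v) real_form(v) is at most 2nm, whence the constant 2 + 2m. *)
Lemma exists_small_form n m : (1 <= n)%nat -> (1 <= m)%nat ->
  exists a : list nat -> R, (forall l, a l = 1 \/ a l = -1) /\
    forall v, (forall j i, is_trit (v j i)) ->
      Rabs (real_form n m a v)
      <= (2 + 2 * INR m) * sqrt (INR n) * sqrt (lprod (seq 0 m) (fun j => sq_norm n (v j))).
Proof.
  intros hn hm.
  assert (hn' : 0 < INR n) by (apply lt_0_INR; lia).
  assert (hm' : 0 < INR m) by (apply lt_0_INR; lia).
  set (rn := sqrt (INR n)). assert (hrn : 0 < rn) by now apply sqrt_lt_R0.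
  assert (hrn2 : rn * rn = INR n) by (apply sqrt_sqrt; lra).
  pose (sg := fun v : nat -> nat -> R => sqrt (lprod (seq 0 m) (fun j => sq_norm n (v j)))).
  pose (cc := fun (v : nat -> nat -> R) l => rn / sg v * lprod (seq 0 m) (fun j => v j (crd l j))).
  (* This weight normalises the bound whatever the value of [cc], in particular when [sg v = 0] and
     the quotient is meaningless. *)
  pose (ww := fun v => exp (- lsum (tuples n m) (fun l => 2 * (cc v l * cc v l)))).
  destruct (exists_signs (list_eq_dec Nat.eq_dec) (tuples n m) (tuples 3 (n * m))
     (fun c => cc (decode n c)) (fun c => ww (decode n c)) (NoDup_tuples n m)) as (a & ha & h).
  exists a; split; auto.
  rewrite (lsum_ext _ (fun c => Rabs _ * _) (fun _ => 1)), lsum_tuples_one in h.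
  2:{ intros c _. unfold ww. rewrite Rabs_right by (left; apply exp_pos).
      rewrite <- exp_plus, Rplus_opp_l. apply exp_0. }
  assert (up : forall v, (forall j i, is_trit (v j i)) ->
     real_form n m a v <= (2 + 2 * INR m) * rn * sg v).
  { intros v hv.
    assert (hP : lsum (tuples n m) (fun l => lprod (seq 0 m) (fun j => v j (crd l j)) * lprod (seq 0 m) (fun j => v j (crd l j)))
       = lprod (seq 0 m) (fun j => sq_norm n (v j))).
    { unfold sq_norm. rewrite <- (lsum_tuples_prod n m (fun j i => v j i * v j i)).
      apply lsum_ext; intros; now rewrite lprod_mult. }
    assert (hP0 : 0 <= lprod (seq 0 m) (fun j => sq_norm n (v j)))
      by (apply lprod_nonneg; intros; apply sq_norm_nonneg).
    assert (hsg : sg v * sg v = lprod (seq 0 m) (fun j => sq_norm n (v j))) by now apply sqrt_sqrt.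
    assert (hsg0 : 0 <= sg v) by apply sqrt_pos.
    destruct hsg0 as [hsg0|hsg0].
    (* If [sg v = 0], the squares of all the products sum to 0, so the form vanishes at v. *)
    2:{ apply Req_le. rewrite <- hsg0, Rmult_0_r.
        unfold real_form. rewrite (lsum_ext _ _ (fun _ => 0)), lsum_const; [ring|].
        intros l hl. assert (h0 : lprod (seq 0 m) (fun j => v j (crd l j)) = 0); [|rewrite h0; ring].
        rewrite <- hsg0, Rmult_0_l, <- hP in hsg. symmetry in hsg.
        apply (lsum_zero_term _ _ l (fun _ _ => Rle_0_sqr _)) in hsg; auto. now apply Rsqr_0_uniq. }
    destruct (decode_surj n m v hv) as (c & hc & hdec).
    assert (hterm := lsum_term_le (tuples 3 (n * m)) (fun c => ww (decode n c) *
        exp (lsum (tuples n m) (fun l => a l * cc (decode n c) l))) c).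
    cbv beta in hterm.
    assert (hterm' : ww (decode n c) * exp (lsum (tuples n m) (fun l => a l * cc (decode n c) l))
       <= exp (2 * INR (n * m))).
    { eapply Rle_trans; [apply hterm; auto|].
      - intros; apply Rmult_le_pos; left; apply exp_pos.
      - eapply Rle_trans; [exact h|]. replace (INR 3) with 3 by (simpl; ring). apply pow3_le_exp. }
    assert (hsgd : sg (decode n c) = sg v).
    { unfold sg. f_equal. apply lprod_ext; intros j hj%in_seq. apply lsum_ext; intros i hi%in_seq.
      rewrite !hdec; auto; lia. }
    assert (hccd : forall l, In l (tuples n m) -> cc (decode n c) l = rn / sg v * lprod (seq 0 m) (fun j => v j (crd l j))).
    { intros l [_ hl]%in_tuples. unfold cc. rewrite hsgd. f_equal. apply lprod_ext; intros j hj%in_seq.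
      apply hdec; [lia|apply hl; lia]. }
    unfold ww in hterm'. rewrite <- exp_plus in hterm'.
    rewrite (lsum_ext _ (fun l => 2 * _) (fun l => 2 * (rn / sg v) * (rn / sg v) * (lprod (seq 0 m) (fun j => v j (crd l j)) * lprod (seq 0 m) (fun j => v j (crd l j))))) in hterm'
      by (intros l hl; rewrite (hccd l hl); ring).
    rewrite (lsum_ext _ (fun l => a l * _) (fun l => rn / sg v * (a l * lprod (seq 0 m) (fun j => v j (crd l j))))) in hterm'
      by (intros l hl; rewrite (hccd l hl); ring).
    rewrite !lsum_scal, hP, <- hsg in hterm'. fold (real_form n m a v) in hterm'.
    assert (hle : - (2 * (rn / sg v) * (rn / sg v) * (sg v * sg v)) + rn / sg v * real_form n m a v <= 2 * INR (n * m)).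
    { destruct (Rle_dec (- (2 * (rn / sg v) * (rn / sg v) * (sg v * sg v)) + rn / sg v * real_form n m a v) (2 * INR (n * m)))
        as [hle|hle]; auto. apply Rnot_le_lt, exp_increasing in hle. lra. }
    replace (2 * (rn / sg v) * (rn / sg v) * (sg v * sg v)) with (2 * (rn * rn)) in hle by (field; lra).
    rewrite mult_INR, <- hrn2 in hle.
    apply Rmult_le_reg_l with (rn / sg v); [apply Rdiv_lt_0_compat; auto|].
    replace (rn / sg v * ((2 + 2 * INR m) * rn * sg v)) with (rn * rn * (2 + 2 * INR m)) by (field; lra).
    lra. }
  intros v hv. change (Rabs (real_form n m a v) <= (2 + 2 * INR m) * rn * sg v).
  (* A sign change in slot 0 preserves the norms and reverses the form, which turns the upper bound
     into one for the absolute value. *)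
  pose (v' := fun j i => v j i * (if Nat.eqb j 0 then -1 else 1)).
  assert (hv' : forall j i, is_trit (v' j i)).
  { intros j i. unfold v', is_trit. destruct (hv j i) as [->|[->| ->]], (Nat.eqb j 0); lra. }
  assert (h1 := up v hv). assert (h2 := up v' hv').
  replace (sg v') with (sg v) in h2.
  2:{ unfold sg. f_equal. apply lprod_ext; intros j _. apply lsum_ext; intros i _. unfold v'.
      destruct (Nat.eqb j 0); ring. }
  replace (real_form n m a v') with (- real_form n m a v) in h2.
  2:{ unfold real_form. rewrite <- (Rmult_1_l (lsum _ _)), Ropp_mult_distr_l, <- lsum_scal.
      apply lsum_ext; intros l _. unfold v'. rewrite lprod_mult, (lprod_single m 0 (-1)) by lia. ring. }
  apply Rabs_le. lra.
Qed.

(** * Forms with given coefficients *)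

Fixpoint cprod (J : list nat) (f : nat -> Cx) : Cx :=
  match J with nil => Defs.C1 | j :: J' => Cmul (f j) (cprod J' f) end.

Lemma cprod_ext J f g : (forall j, In j J -> f j = g j) -> cprod J f = cprod J g.
Proof. induction J; simpl; intros h; [auto|rewrite h, IHJ; auto]. Qed.

Lemma cprod_inK K J f : (forall j, In j J -> inK K (f j)) -> inK K (cprod J f).
Proof.
  induction J; simpl; intros h; [apply inK_real|]. apply inK_Cmul; auto.
Qed.

Lemma cprod_real J (f : nat -> R) : cprod J (fun j => (f j, 0)) = (lprod J f, 0).
Proof.
  induction J; simpl; auto. rewrite IHJ. unfold Cmul; simpl. f_equal; ring.
Qed.

Lemma Cabs_cprod J f : Cabs (cprod J f) = lprod J (fun j => Cabs (f j)).
Proof.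
  induction J; simpl; [unfold Defs.C1; rewrite Cabs_real; apply Rabs_R1|].
  now rewrite Cabs_mul, IHJ.
Qed.

Lemma cprod_extract J k z g : NoDup J -> In k J ->
  cprod J (fun j => if Nat.eqb j k then z else g j)
  = Cmul z (cprod J (fun j => if Nat.eqb j k then Defs.C1 else g j)).
Proof.
  induction J as [|j J IH]; simpl; [tauto|]. intros hnd [->|hk]; inversion_clear hnd as [|? ? hj hJ].
  - rewrite Nat.eqb_refl.
    rewrite (cprod_ext J _ (fun j => if Nat.eqb j k then Defs.C1 else g j)).
    + unfold Cmul, Defs.C1; simpl; f_equal; ring.
    + intros i hi. destruct (Nat.eqb_spec i k); congruence.
  - rewrite IH by auto. destruct (Nat.eqb_spec j k); [congruence|].
    unfold Cmul; simpl; f_equal; ring.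
Qed.

(** Real coefficients make this a form over both scalar fields. *)
Definition form (m n : nat) (a : list nat -> R) (x : nat -> nat -> Cx) : Cx :=
  (lsum (tuples n m) (fun l => a l * fst (cprod (seq 0 m) (fun j => x j (crd l j)))),
   lsum (tuples n m) (fun l => a l * snd (cprod (seq 0 m) (fun j => x j (crd l j))))).

Lemma form_multilinear K m n a : is_multilinear K m n (form m n a).
Proof.
  split; [|split].
  - intros x y h. unfold form.
    assert (e : forall l, In l (tuples n m) -> cprod (seq 0 m) (fun j => x j (crd l j)) = cprod (seq 0 m) (fun j => y j (crd l j))).
    { intros l [_ hl]%in_tuples. apply cprod_ext; intros j hj%in_seq. apply h; [lia|apply hl; lia]. }
    f_equal; apply lsum_ext; intros l hl; now rewrite e.
  - intros x hx. destruct K; simpl; auto.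
    rewrite (lsum_ext _ _ (fun _ => 0)), lsum_const; [ring|].
    intros l [_ hl]%in_tuples. assert (h := cprod_inK Kreal (seq 0 m) (fun j => x j (crd l j))).
    simpl in h. rewrite h; [ring|]. intros j hj%in_seq. apply (hx j (crd l j)); [lia|apply hl; lia].
  - intros x k al u v hk _ _ _ _.
    assert (e : forall w l, cprod (seq 0 m) (fun j => upd x k w j (crd l j))
       = Cmul (w (crd l k)) (cprod (seq 0 m) (fun j => if Nat.eqb j k then Defs.C1 else x j (crd l j)))).
    { intros w l. rewrite <- cprod_extract by (apply seq_NoDup || (apply in_seq; lia)).
      apply cprod_ext; intros j _. unfold upd. destruct (Nat.eqb_spec j k) as [->|]; auto. }
    unfold form, Cadd. unfold Cmul at 1 2. simpl.
    f_equal; [unfold Rminus; rewrite Ropp_mult_distr_l|]; rewrite <- !lsum_scal, <- !lsum_plus;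
      apply lsum_ext; intros l _; rewrite !e; unfold Cmul, Cadd; simpl; ring.
Qed.

Lemma form_real m n a v : form m n a (fun j => cv (v j)) = (real_form n m a v, 0).
Proof.
  unfold form, real_form, cv. f_equal.
  - apply lsum_ext; intros l _. now rewrite (cprod_real (seq 0 m) (fun j => v j (crd l j))).
  - rewrite (lsum_ext _ _ (fun _ => 0)), lsum_const; [ring|].
    intros l _. rewrite (cprod_real (seq 0 m) (fun j => v j (crd l j))). simpl; ring.
Qed.

Lemma lsum_single {A} (L : list A) (f : A -> R) x : NoDup L -> In x L ->
  (forall y, In y L -> y <> x -> f y = 0) -> lsum L f = f x.
Proof.
  induction L as [|y L IH]; simpl; [tauto|]. intros hnd hx h. inversion_clear hnd as [|? ? hy hL].
  destruct hx as [->|hx].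
  - rewrite (lsum_ext L f (fun _ => 0)), lsum_const; [ring|].
    intros z hz. apply h; auto. congruence.
  - rewrite IH by auto. rewrite h; [ring|auto|congruence].
Qed.

Lemma tuple_diff n m l l' : In l (tuples n m) -> In l' (tuples n m) -> l <> l' ->
  exists j, (j < m)%nat /\ crd l j <> crd l' j.
Proof.
  intros [h1 _]%in_tuples [h2 _]%in_tuples.
  revert l l' h1 h2. induction m as [|m IH]; intros l l' h1 h2 hne.
  - destruct l, l'; try discriminate. tauto.
  - destruct l as [|i l], l' as [|i' l']; try discriminate.
    destruct (Nat.eq_dec i i') as [->|hi]; [|exists O; split; [lia|auto]].
    destruct (IH l l') as (j & hj & hd); try (simpl in *; lia); [congruence|].
    exists (S j). split; [lia|auto].
Qed.

Lemma coef_form m n a l : In l (tuples n m) -> coef (form m n a) l = Rabs (a l).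
Proof.
  intros hl. unfold coef, coefabs.
  replace (fun j => unitv (crd l j)) with (fun j => cv (fun i => if Nat.eqb i (crd l j) then 1 else 0))
    by (apply functional_extensionality; intros; now rewrite unitv_cv).
  rewrite (form_real m n a (fun j i => if Nat.eqb i (crd l j) then 1 else 0)), Cabs_real.
  unfold real_form. rewrite (lsum_single (tuples n m) _ l (NoDup_tuples n m) hl).
  - rewrite (lprod_ext _ _ (fun _ => rpow 1 1)) by (intros; now rewrite Nat.eqb_refl, rpow_1_l).
    rewrite lprod_rpow_const, rpow_1_l by lra. now rewrite Rmult_1_r.
  - intros l' hl' hne. destruct (tuple_diff n m l' l hl' hl hne) as (j & hj & hd).
    rewrite (lprod_zero _ _ j); [ring|apply in_seq; lia|]. destruct (Nat.eqb_spec (crd l' j) (crd l j)); tauto.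
Qed.

(** * From signs to arbitrary vectors *)

Lemma Cabs_triangle z w : Cabs (Cadd z w) <= Cabs z + Cabs w.
Proof.
  assert (hz := Cabs_nonneg z). assert (hw := Cabs_nonneg w).
  assert (h1 := Cabs_sq z). assert (h2 := Cabs_sq w).
  apply Rsqr_incr_0_var; [|lra]. unfold Rsqr. rewrite Cabs_sq.
  destruct z as [a b], w as [c d]; simpl in *.
  set (Z := Cabs (a, b)) in *. set (W := Cabs (c, d)) in *.
  assert (h : (a * c + b * d) * (a * c + b * d) <= (Z * W) * (Z * W)).
  { replace ((Z * W) * (Z * W)) with ((Z * Z) * (W * W)) by ring. rewrite h1, h2.
    assert (0 <= (a * d - b * c) * (a * d - b * c)) by apply Rle_0_sqr. lra. }
  assert (a * c + b * d <= Z * W); [|lra].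
  assert (0 <= Z * W) by (apply Rmult_le_pos; auto).
  destruct (Rle_dec (a * c + b * d) 0); [lra|]. apply Rsqr_incr_0_var; auto.
Qed.

Lemma Cabs_csum n f : Cabs (csum n f) <= lsum (seq 0 n) (fun i => Cabs (f i)).
Proof.
  induction n.
  - unfold csum; simpl. rewrite Cabs_real, Rabs_R0. lra.
  - rewrite csum_S, lsum_seq_S. eapply Rle_trans; [apply Cabs_triangle|]. lra.
Qed.

Definition harm (n : nat) : R := lsum (seq 0 n) (fun i => / INR (S i)).

Lemma harm_nonneg n : 0 <= harm n.
Proof.
  apply lsum_nonneg; intros. left. apply Rinv_0_lt_compat, lt_0_INR; lia.
Qed.

Lemma harm_le n : (1 <= n)%nat -> harm n <= 1 + ln (INR n).
Proof.
  intros hn. induction n as [|n IH]; [lia|]. unfold harm. rewrite lsum_seq_S. fold (harm n).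
  destruct n as [|n]; [unfold harm; simpl; rewrite ln_1, Rinv_1; lra|].
  specialize (IH ltac:(lia)).
  assert (h1 : 0 < INR (S n)) by (apply lt_0_INR; lia).
  assert (h2 : 0 < INR (S (S n))) by (apply lt_0_INR; lia).
  assert (h : ln (INR (S n)) - ln (INR (S (S n))) <= - / INR (S (S n))).
  { replace (ln (INR (S n)) - ln (INR (S (S n)))) with (ln (INR (S n) / INR (S (S n))))
      by (unfold Rdiv; rewrite ln_mult, ln_Rinv by (auto; now apply Rinv_0_lt_compat); ring).
    replace (- / INR (S (S n))) with (INR (S n) / INR (S (S n)) - 1)
      by (rewrite (S_INR (S n)) in *; field; lra).
    assert (h0 : 0 < INR (S n) / INR (S (S n))) by now apply Rdiv_lt_0_compat.
    assert (h3 := exp_ineq1_le (ln (INR (S n) / INR (S (S n))))). rewrite exp_ln in h3 by auto. lra. }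
  lra.
Qed.

Lemma list_remove_min {A} (S : list A) (c : A -> R) : S <> nil -> NoDup S ->
  exists x S', NoDup S' /\ incl S' S /\ length S = Datatypes.S (length S') /\
    (forall f, lsum S f = f x + lsum S' f) /\ forall y, In y S -> c x <= c y.
Proof.
  intros hS hnd. destruct (list_argmax S (fun y => - c y) hS) as (x & hx & hmin).
  destruct (in_split x S hx) as (l1 & l2 & ->).
  exists x, (l1 ++ l2). repeat split.
  - now apply NoDup_remove_1 in hnd.
  - intros y hy. apply in_app_iff in hy. apply in_app_iff. simpl. tauto.
  - rewrite !length_app. simpl. lia.
  - intros f. rewrite !lsum_app. simpl. ring.
  - intros y hy. specialize (hmin y hy). lra.
Qed.

(* The smallest of the N remaining values is at most B / sqrt N, so peeling off minima costs a
   harmonic sum. *)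
Lemma weak_l2 {A} (P : list A -> Prop) (c : A -> R) B : 0 <= B -> (forall i, 0 <= c i) ->
  (forall S S', incl S' S -> P S -> P S') ->
  (forall S, NoDup S -> P S -> lsum S c <= B * sqrt (INR (length S))) ->
  forall S, NoDup S -> P S -> lsum S (fun i => c i * c i) <= B * B * harm (length S).
Proof.
  intros hB hc hP h S. remember (length S) as N eqn:hN. revert S hN.
  induction N as [|N IH]; intros S hN hnd hS.
  - destruct S; [|discriminate]. simpl. unfold harm; simpl. lra.
  - destruct (list_remove_min S c) as (x & S' & hnd' & hincl & hlen & hsum & hmin); auto.
    { intros ->; discriminate. }
    rewrite hsum. unfold harm. rewrite lsum_seq_S. fold (harm N).
    assert (h1 := IH S' ltac:(lia) hnd' (hP _ _ hincl hS)).
    assert (h2 := h S hnd hS).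
    assert (h3 : INR (length S) * c x <= lsum S c) by (rewrite <- lsum_const; apply lsum_le; auto).
    rewrite <- hN in *. set (M := INR (Datatypes.S N)) in *.
    assert (hM : 0 < M) by (apply lt_0_INR; lia).
    assert (hsq : sqrt M * sqrt M = M) by (apply sqrt_sqrt; lra).
    assert (hs0 : 0 < sqrt M) by now apply sqrt_lt_R0.
    set (q := sqrt M) in *.
    assert (h4 : q * c x <= B).
    { apply Rmult_le_reg_l with q; auto. rewrite <- Rmult_assoc, hsq. lra. }
    assert (h5 : c x * c x <= B * B * / M).
    { apply Rmult_le_reg_r with M; auto. replace (B * B * / M * M) with (B * B) by (field; lra).
      rewrite <- hsq. replace (c x * c x * (q * q)) with ((q * c x) * (q * c x)) by ring.
      assert (0 <= q * c x) by (apply Rmult_le_pos; auto; lra).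
      apply Rmult_le_compat; auto. }
    lra.
Qed.

Lemma lsum_seq_indicator n S (f : nat -> R) : NoDup S -> incl S (seq 0 n) ->
  lsum (seq 0 n) (fun i => if in_dec Nat.eq_dec i S then f i else 0) = lsum S f.
Proof.
  induction S as [|x S IH]; intros hnd hin; simpl.
  - rewrite lsum_const; ring.
  - inversion_clear hnd as [|? ? hx hS].
    rewrite <- IH by (auto; intros y hy; apply hin; now right).
    assert (hxn : (x < n)%nat) by (assert (h := hin x (or_introl eq_refl)); apply in_seq in h; lia).
    rewrite <- (lsum_seq_single n x f hxn), <- lsum_plus. apply lsum_ext; intros i _.
    destruct (Nat.eqb_spec i x) as [-> |hix].
    + destruct (in_dec Nat.eq_dec x S); [tauto|].
      destruct (Nat.eq_dec x x); [ring|congruence].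
    + destruct (Nat.eq_dec x i); [congruence|]. destruct (in_dec Nat.eq_dec i S); ring.
Qed.

(** Testing with the signs of c on a support S gives sum_S |c| <= B sqrt(|S|), the hypothesis of
    [weak_l2]. *)
Lemma l2_bound_of_trits n (c : nat -> R) B : 0 <= B ->
  (forall v, (forall i, is_trit (v i)) ->
     lsum (seq 0 n) (fun i => v i * c i) <= B * sqrt (sq_norm n v)) ->
  sq_norm n c <= B * B * harm n.
Proof.
  intros hB h. unfold sq_norm.
  rewrite (lsum_ext _ _ (fun i => Rabs (c i) * Rabs (c i)))
    by (intros; rewrite <- Rabs_mult; rewrite Rabs_right; auto; apply Rle_ge, Rle_0_sqr).
  replace n with (length (seq 0 n)) at 2 by apply length_seq.
  apply (weak_l2 (fun S => incl S (seq 0 n))); auto using seq_NoDup, incl_refl.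
  - intros; apply Rabs_pos.
  - intros S S' h1 h2 x hx; auto.
  - intros S hnd hS.
    pose (sgn := fun i => if Rle_dec 0 (c i) then 1 else -1).
    pose (v := fun i => if in_dec Nat.eq_dec i S then sgn i else 0).
    assert (hv : forall i, is_trit (v i)).
    { intros i. unfold v, sgn, is_trit. destruct in_dec; auto. destruct Rle_dec; auto. }
    specialize (h v hv).
    rewrite (lsum_ext _ _ (fun i => if in_dec Nat.eq_dec i S then Rabs (c i) else 0)),
      lsum_seq_indicator in h; auto.
    + eapply Rle_trans; [exact h|]. apply Req_le. f_equal. f_equal. unfold sq_norm.
      rewrite (lsum_ext _ _ (fun i => if in_dec Nat.eq_dec i S then 1 else 0)), lsum_seq_indicator; auto.
      * rewrite lsum_const; ring.
      * intros i _. unfold v, sgn. destruct in_dec; [destruct Rle_dec|]; ring.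
    + intros i _. unfold v, sgn. destruct in_dec; [|ring].
      destruct (Rle_dec 0 (c i)).
      * rewrite Rabs_right; lra.
      * rewrite Rabs_left; lra.
Qed.

Definition l2n (n : nat) (x : nat -> Cx) : R := sqrt (lsum (seq 0 n) (fun i => Cabs (x i) * Cabs (x i))).

Lemma l2n_nonneg n x : 0 <= l2n n x.
Proof. apply sqrt_pos. Qed.

Lemma l2n_cv n v : l2n n (cv v) = sqrt (sq_norm n v).
Proof.
  unfold l2n, sq_norm. f_equal. apply lsum_ext; intros i _. unfold cv. rewrite Cabs_real, <- Rabs_mult.
  apply Rabs_right, Rle_ge, Rle_0_sqr.
Qed.

Lemma lprod_upd m k (x : nat -> nat -> Cx) w (N : (nat -> Cx) -> R) : (k < m)%nat ->
  lprod (seq 0 m) (fun j => N (upd x k w j))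
  = N w * lprod (seq 0 m) (fun j => if Nat.eqb j k then 1 else N (x j)).
Proof.
  intros hk. rewrite <- (lprod_single m k (N w) hk) at 1. rewrite <- lprod_mult.
  apply lprod_ext; intros j _. unfold upd. destruct (Nat.eqb j k); ring.
Qed.

Section Extend.
Variables (m n : nat) (T : (nat -> nat -> Cx) -> Cx).
Hypothesis hT : is_multilinear Kcomplex m n T.

(** With the other slots fixed, T is a functional with coefficients c_i, its values at the unit
    vectors. The real and imaginary parts of c are bounded separately, hence the factor 2, and
    Cauchy-Schwarz covers all w. *)
Lemma form_slot_bound s x B : (s < m)%nat -> 0 <= B ->
  (forall v, (forall i, is_trit (v i)) -> Cabs (T (upd x s (cv v))) <= B * sqrt (sq_norm n v)) ->
  forall w, Cabs (T (upd x s w)) <= B * sqrt (2 * harm n) * l2n n w.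
Proof.
  intros hs hB h w.
  assert (hx : admissible Kcomplex m n x) by (intros j i _ _; exact I).
  pose (c := fun i => T (upd x s (cv (dl i (fun _ => 1))))).
  assert (hpart : forall b, sq_norm n (fun i => part b (c i)) <= B * B * harm n).
  { intros b. apply l2_bound_of_trits; auto. intros v hv.
    eapply Rle_trans; [|apply h; auto].
    assert (e : T (upd x s (cv v)) = csum n (fun i => Cmul (v i, 0) (c i))).
    { unfold c. rewrite <- (form_signed Kcomplex m n T hT) by auto.
      apply (form_ext _ _ _ _ hT). intros j i _ _. unfold upd. destruct (Nat.eqb j s); auto.
      unfold cv. f_equal; ring. }
    rewrite e. set (z := csum n _).
    assert (hz : lsum (seq 0 n) (fun i => v i * part b (c i)) = part b z).
    { unfold z, csum, part. destruct b; simpl; apply lsum_ext; intros; ring. }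
    rewrite hz. assert (h1 := Cabs_sq z). assert (h2 := Cabs_nonneg z).
    destruct (Rle_dec (part b z) 0); [lra|]. apply Rsqr_incr_0_var; auto. unfold Rsqr.
    assert (h3 := Rle_0_sqr (fst z)). assert (h4 := Rle_0_sqr (snd z)). unfold Rsqr in *.
    unfold part. destruct b; lra. }
  assert (hc : lsum (seq 0 n) (fun i => Cabs (c i) * Cabs (c i)) <= B * B * (2 * harm n)).
  { rewrite (lsum_ext _ _ (fun i => part true (c i) * part true (c i) + part false (c i) * part false (c i)))
      by (intros; apply Cabs_sq).
    rewrite lsum_plus. assert (h1 := hpart true). assert (h2 := hpart false). unfold sq_norm in *. lra. }
  assert (e : T (upd x s w) = csum n (fun i => Cmul (w i) (c i))).
  { unfold c. rewrite <- (form_csum Kcomplex m n T hT n x s w (fun i => cv (dl i (fun _ => 1))))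
      by (auto; intros; exact I).
    apply (form_ext _ _ _ _ hT). intros j i _ hi. unfold upd. destruct (Nat.eqb j s); auto.
    unfold csum, cv, dl, Cmul; simpl. rewrite (surjective_pairing (w i)). f_equal; symmetry.
    - rewrite (lsum_ext _ _ (fun i0 => if Nat.eqb i0 i then fst (w i0) else 0)), (lsum_seq_single n i (fun i0 => fst (w i0))); auto.
      intros i0 _. rewrite (Nat.eqb_sym i). destruct (Nat.eqb i0 i); ring.
    - rewrite (lsum_ext _ _ (fun i0 => if Nat.eqb i0 i then snd (w i0) else 0)), (lsum_seq_single n i (fun i0 => snd (w i0))); auto.
      intros i0 _. rewrite (Nat.eqb_sym i). destruct (Nat.eqb i0 i); ring. }
  rewrite e. eapply Rle_trans; [apply Cabs_csum|].
  rewrite (lsum_ext _ _ (fun i => Cabs (w i) * Cabs (c i))) by (intros; apply Cabs_mul).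
  assert (hcs := cauchy_schwarz (seq 0 n) (fun i => Cabs (w i)) (fun i => Cabs (c i))).
  cbv beta in hcs. set (X := lsum _ (fun i => Cabs (w i) * Cabs (c i))) in *.
  set (W := lsum _ (fun i => Cabs (w i) * Cabs (w i))) in *.
  assert (hW : 0 <= W) by (apply lsum_nonneg; intros; apply Rle_0_sqr).
  assert (hh : 0 <= 2 * harm n) by (assert (h1 := harm_nonneg n); lra).
  apply Rsqr_incr_0_var; [|apply Rmult_le_pos; [apply Rmult_le_pos; auto; apply sqrt_pos|apply l2n_nonneg]].
  unfold Rsqr. unfold l2n. fold W.
  replace (B * sqrt (2 * harm n) * sqrt W * (B * sqrt (2 * harm n) * sqrt W))
    with (B * B * (sqrt (2 * harm n) * sqrt (2 * harm n)) * (sqrt W * sqrt W)) by ring.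
  rewrite !sqrt_sqrt by auto.
  replace (X ^ 2) with (X * X) in hcs by ring.
  eapply Rle_trans; [exact hcs|]. rewrite (Rmult_comm W). apply Rmult_le_compat_r; auto.
Qed.

Lemma form_l2_bound B : 0 <= B ->
  (forall v, (forall j i, is_trit (v j i)) ->
     Cabs (T (fun j => cv (v j))) <= B * lprod (seq 0 m) (fun j => sqrt (sq_norm n (v j)))) ->
  forall x, Cabs (T x) <= B * sqrt (2 * harm n) ^ m * lprod (seq 0 m) (fun j => l2n n (x j)).
Proof.
  intros hB h.
  (* Hybrid arguments: the slots below s are arbitrary, the others still have entries in {-1, 0, 1}.
     Each slot released costs a factor sqrt(2 harm n). *)
  enough (H : forall s, (s <= m)%nat -> forall x v, (forall j i, is_trit (v j i)) ->
    (forall j, (s <= j < m)%nat -> x j = cv (v j)) ->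
    Cabs (T x) <= B * sqrt (2 * harm n) ^ s * lprod (seq 0 m) (fun j => l2n n (x j))).
  { intros x. apply (H m (le_n m) x (fun _ _ => 0)); [intros; left; auto|]. intros; lia. }
  induction s as [|s IH]; intros hs x v hv hx.
  - rewrite pow_O, Rmult_1_r.
    rewrite (form_ext _ _ _ _ hT x (fun j => cv (v j))) by (intros; rewrite hx; auto; lia).
    rewrite (lprod_ext _ _ (fun j => sqrt (sq_norm n (v j)))); auto.
    intros j hj%in_seq. rewrite hx by lia. apply l2n_cv.
  - set (kp := sqrt (2 * harm n)) in *. assert (hkp : 0 <= kp) by apply sqrt_pos.
    set (Q := lprod (seq 0 m) (fun j => if Nat.eqb j s then 1 else l2n n (x j))).
    assert (hQ : 0 <= Q).
    { apply lprod_nonneg; intros j _. destruct (Nat.eqb j s); [lra|apply l2n_nonneg]. }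
    assert (hb := form_slot_bound s x (B * kp ^ s * Q)).
    assert (hself : upd x s (x s) = x).
    { apply functional_extensionality; intros j. unfold upd. destruct (Nat.eqb_spec j s); congruence. }
    rewrite <- hself at 1.
    eapply Rle_trans; [apply hb; auto|].
    + repeat apply Rmult_le_pos; auto. now apply pow_le.
    + intros u hu. eapply Rle_trans; [apply (IH ltac:(lia) _ (upd v s u))|].
      * intros j i. unfold upd. destruct (Nat.eqb j s); auto.
      * intros j hj. unfold upd. destruct (Nat.eqb_spec j s); auto. apply hx; lia.
      * rewrite lprod_upd by lia. fold Q. rewrite l2n_cv. apply Req_le; ring.
    + assert (e : lprod (seq 0 m) (fun j => l2n n (x j)) = l2n n (x s) * Q)
        by (unfold Q; rewrite <- lprod_upd by lia; now rewrite hself).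
      rewrite e. fold kp. apply Req_le. simpl; ring.
Qed.
End Extend.

(** As 1/q <= 1/2, the l_2 norm is compared with that of a larger exponent; for the sup norm each
    entry is bounded by 1. *)
Lemma l2n_le_lp q n (x : nat -> Cx) : (1 <= n)%nat -> ext_ge1 q -> ext_inv q <= / 2 -> lp_norm q n x <= 1 ->
  l2n n x <= rpow (INR n) (/ 2 - ext_inv q).
Proof.
  intros hn hq hq2 hx. unfold l2n.
  assert (h2 : 0 <= lsum (seq 0 n) (fun i => Cabs (x i) * Cabs (x i)))
    by (apply lsum_nonneg; intros; apply Rle_0_sqr).
  rewrite <- rpow_sqrt by auto.
  destruct q as [a|]; simpl in *.
  - rewrite fsum_lsum in hx.
    assert (ha : 2 <= a).
    { rewrite <- (Rinv_inv a), <- (Rinv_inv 2). apply Rinv_le_contravar; auto. apply Rinv_0_lt_compat; lra. }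
    rewrite (lsum_ext _ _ (fun i => rpow (Cabs (x i)) 2)) by (intros; rewrite rpow_2_r; auto; apply Cabs_nonneg).
    eapply Rle_trans; [apply power_mean with (q := a)|].
    + intros; apply Cabs_nonneg.
    + lra.
    + rewrite <- (Rmult_1_r (rpow (INR n) (/ 2 - / a))) at 2.
      apply Rmult_le_compat_l; auto. apply rpow_nonneg.
  - rewrite Rminus_0_r. apply rpow_le; [|lra]. split; auto.
    replace (INR n) with (lsum (seq 0 n) (fun _ => 1)) by (rewrite lsum_const, length_seq; ring).
    apply lsum_le; intros i hi%in_seq.
    assert (h : Cabs (x i) <= 1).
    { apply (lp_norm_coord Inf n x i); simpl; auto; lia. }
    assert (h0 := Cabs_nonneg (x i)). nra.
Qed.

(** * Optimality *)

(** The assumed inequalities concern forms together with a least upper bound of their values;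
    completeness supplies one from any bound. *)
Lemma norm_exists K m n p T M : (forall j, (j < m)%nat -> ext_ge1 (p j)) ->
  (forall x, admissible K m n x -> (forall j, (j < m)%nat -> lp_norm (p j) n (x j) <= 1) -> Cabs (T x) <= M) ->
  exists N, is_lub (norm_set K m n p T) N /\ 0 <= N <= M.
Proof.
  intros hp hM.
  assert (hub : is_upper_bound (norm_set K m n p T) M) by (intros t (x & h1 & h2 & ->); auto).
  assert (h0 : norm_set K m n p T (Cabs (T (fun j => cv (fun _ => 0))))) by now apply zero_in_norm_set.
  destruct (completeness (norm_set K m n p T)) as (N & hN); [exists M; auto|eauto|].
  exists N. split; auto. split; [|apply hN; auto].
  apply Rle_trans with (2 := proj1 hN _ h0). apply Cabs_nonneg.
Qed.

Lemma mx_one n m r : (1 <= n)%nat -> (forall j, (j < m)%nat -> 0 < r j) ->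
  mx n m r (fun _ => 1) = rpow (INR n) (lsum (seq 0 m) (fun j => / r j)).
Proof.
  intros hn. assert (hn' : 0 < INR n) by (apply lt_0_INR; lia).
  revert r; induction m as [|m IH]; intros r hr; [simpl; now rewrite rpow_0_r|].
  rewrite lsum_seq_shift, rpow_plus by lra. cbn [mx].
  assert (hr0 := hr O ltac:(lia)).
  rewrite (IH (fun j => r (S j))) by (intros; apply hr; lia).
  rewrite lsum_const, length_seq, rpow_mult_distr, rpow_inv_cancel; try apply rpow_nonneg; try lra.
Qed.

Lemma mx_ge n m r a l : (forall j, (j < m)%nat -> 0 < r j) -> (forall l, 0 <= a l) ->
  In l (tuples n m) -> a l <= mx n m r a.
Proof.
  revert r a l; induction m as [|m IH]; intros r a l hr ha hl.
  - destruct hl as [<-|[]]. simpl. lra.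
  - apply in_tuples_S in hl as (i & l' & -> & hi & hl). cbn [mx]. assert (hr0 := hr O ltac:(lia)).
    eapply Rle_trans; [apply (IH (fun j => r (S j)) (fun l => a (i :: l)) l'); auto; intros; apply hr; lia|].
    set (M := fun i => mx n m (fun j => r (S j)) (fun l => a (i :: l))).
    assert (hM : forall i, 0 <= M i) by (intros; apply mx_nonneg; auto).
    change (M i <= rpow (lsum (seq 0 n) (fun i => rpow (M i) (r O))) (/ r O)).
    apply rpow_le_inv with (r O); auto; try apply rpow_nonneg.
    rewrite rpow_inv_cancel' by (try lra; apply lsum_nonneg; intros; apply rpow_nonneg).
    apply (lsum_term_le _ (fun i => rpow (M i) (r O))); [intros; apply rpow_nonneg|apply in_seq; lia].
Qed.

Lemma power_unbounded ep C : 0 < ep -> (forall n, (1 <= n)%nat -> Rpower (INR n) ep <= C) -> False.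
Proof.
  intros hep h.
  assert (hC : 0 < C) by (apply Rlt_le_trans with (2 := h 1%nat (le_n 1)); apply exp_pos).
  destruct (INR_unbounded (Rpower (C + 1) (/ ep))) as (n & hn).
  assert (hp := Rpower_pos (C + 1) (/ ep)).
  assert (hn1 : (1 <= n)%nat) by (destruct n; [simpl in hn; lra|lia]).
  assert (h1 : Rpower (Rpower (C + 1) (/ ep)) ep < Rpower (INR n) ep) by (apply Rlt_Rpower_l; lra).
  rewrite Rpower_mult, Rinv_l, Rpower_1 in h1 by lra. specialize (h n hn1). lra.
Qed.

(** From exp(x) >= 1 + x with x = ep ln n; logarithmic losses are thereby dominated by any positive
    power of n. *)
Lemma log_le_power ep : 0 < ep -> forall n, (1 <= n)%nat ->
  2 * (1 + ln (INR n)) <= 2 * (1 + / ep) * Rpower (INR n) ep.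
Proof.
  intros hep n hn. assert (hn' : 1 <= INR n) by now apply (le_INR 1).
  assert (h1 : 0 <= ln (INR n)).
  { rewrite <- ln_1. destruct hn' as [h|<-]; [left; apply ln_increasing; lra|lra]. }
  assert (h2 : 1 <= Rpower (INR n) ep).
  { unfold Rpower. assert (h := exp_ineq1_le (ep * ln (INR n))).
    assert (0 <= ep * ln (INR n)) by (apply Rmult_le_pos; lra). lra. }
  assert (h3 : ep * ln (INR n) <= Rpower (INR n) ep).
  { unfold Rpower. assert (h := exp_ineq1_le (ep * ln (INR n))). lra. }
  assert (h4 : ln (INR n) <= / ep * Rpower (INR n) ep).
  { apply Rmult_le_reg_l with ep; auto. rewrite <- Rmult_assoc, Rinv_r; lra. }
  lra.
Qed.

Section Optimality.
Variables (K : field_kind) (m : nat) (p : nat -> ext) (r : nat -> R) (D s : R).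
Hypothesis hm : (1 <= m)%nat.
Hypothesis hp : forall j, (j < m)%nat -> ext_ge1 (p j).
Hypothesis hpU : sum_inv m p <= 1 / 2.
Hypothesis hr : forall j, (j < m)%nat -> 1 <= r j <= 2.
Hypothesis hD : forall (n : nat) (T : (nat -> nat -> Cx) -> Cx) (normT : R),
  (1 <= n)%nat -> is_multilinear K m n T -> is_lub (norm_set K m n p T) normT ->
  mixed_sum m n r T <= D * Rpower (INR n) s * normT.

Let hr0 : forall j, (j < m)%nat -> 0 < r j.
Proof. intros j hj. specialize (hr j hj). lra. Qed.

Let hinv : forall j, (j < m)%nat -> 0 <= ext_inv (p j) <= / 2.
Proof.
  assert (h0 : forall j, (j < m)%nat -> 0 <= ext_inv (p j)).
  { intros j hj. specialize (hp j hj). destruct (p j); simpl in *; [|lra].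
    left; apply Rinv_0_lt_compat; lra. }
  intros j hj. split; auto. apply Rle_trans with (sum_inv m p); [|lra].
  unfold sum_inv. rewrite fsum_lsum. apply (lsum_term_le _ (fun j => ext_inv (p j))); [|apply in_seq; lia].
  intros i hi%in_seq. apply h0; lia.
Qed.

(** The form prod_j x_j(0) has norm at most 1 and a coefficient equal to 1, so n^(-s) <= |D| for all
    n, which excludes s < 0. *)
Lemma exponent_nonneg : 0 <= s.
Proof.
  apply Rnot_lt_le; intros hs.
  apply (power_unbounded (- s) (Rabs D)); [lra|]. intros n hn.
  assert (hn' : 0 < INR n) by (apply lt_0_INR; lia).
  pose (z := repeat O m).
  assert (hz : In z (tuples n m)).
  { apply in_tuples. unfold z. rewrite repeat_length. split; auto.
    intros j hj. unfold crd. rewrite nth_repeat. lia. }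
  pose (a := fun l => if list_eq_dec Nat.eq_dec l z then 1 else 0).
  destruct (norm_exists K m n p (form m n a) 1 hp) as (N & hN & hN1).
  { intros x _ hx.
    assert (e : form m n a x = cprod (seq 0 m) (fun j => x j (crd z j))).
    { unfold form. rewrite !(lsum_single (tuples n m) _ z (NoDup_tuples n m) hz).
      - unfold a. destruct (list_eq_dec Nat.eq_dec z z); [|congruence]. rewrite !Rmult_1_l.
        now destruct (cprod _ _).
      - intros l _ hl. unfold a. destruct (list_eq_dec Nat.eq_dec l z); [congruence|ring].
      - intros l _ hl. unfold a. destruct (list_eq_dec Nat.eq_dec l z); [congruence|ring]. }
    rewrite e, Cabs_cprod.
    apply Rle_trans with (lprod (seq 0 m) (fun _ => rpow 1 1)).
    - apply lprod_le; intros j hj%in_seq. split; [apply Cabs_nonneg|]. rewrite rpow_1_l.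
      apply (lp_norm_coord (p j) n); [apply hp; lia| |apply hx; lia].
      apply in_tuples in hz. apply hz; lia.
    - rewrite lprod_rpow_const, rpow_1_l; lra. }
  assert (h := hD n (form m n a) N hn (form_multilinear K m n a) hN).
  rewrite (mixed_sum_mx K) in h by (auto; apply form_multilinear).
  assert (h1 : 1 <= mx n m r (coef (form m n a))).
  { apply Rle_trans with (coef (form m n a) z).
    - rewrite coef_form by auto. unfold a. destruct (list_eq_dec Nat.eq_dec z z); [|congruence].
      rewrite Rabs_R1; lra.
    - apply mx_ge; auto. intros; apply Cabs_nonneg. }
  assert (hps := Rpower_pos (INR n) s).
  (* The sign of [D] is unknown, so its absolute value is taken before [N <= 1] is used. *)
  assert (h2 : 1 <= Rabs D * Rpower (INR n) s).
  { apply Rle_trans with (D * Rpower (INR n) s * N); [lra|].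
    rewrite <- (Rmult_1_r (Rabs D * _)).
    apply Rle_trans with (Rabs D * Rpower (INR n) s * N).
    - apply Rmult_le_compat_r; [lra|]. apply Rmult_le_compat_r; [lra|]. apply Rle_abs.
    - apply Rmult_le_compat_l; [|lra]. apply Rmult_le_pos; [apply Rabs_pos|lra]. }
  rewrite Rpower_Ropp. apply Rmult_le_reg_r with (Rpower (INR n) s); auto.
  rewrite Rinv_l by lra. exact h2.
Qed.

(** The random form has mixed norm n^(|1/r|) and norm at most a constant times n^(1/2 + m/2 - U)
    times a power of the logarithm; a gap E - s > 0 would survive that logarithm. *)
Lemma exponent_ge : fsum m (fun j => / r j) - (INR m + 1) / 2 + sum_inv m p <= s.
Proof.
  set (E := fsum m _ - _ + _). apply Rnot_lt_le; intros hs.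
  assert (hm' : 0 < INR m) by (apply lt_0_INR; lia).
  (* Each of the m logarithmic factors is at most a constant times n^(ep/2). Together they use up
     half of the gap E - s; the other half yields an unbounded power of n. *)
  pose (ep := (E - s) / INR m). assert (hep : 0 < ep) by (apply Rdiv_lt_0_compat; lra).
  set (c0 := 2 + 2 * INR m). set (c1 := sqrt (2 * (1 + / ep)) ^ m).
  assert (hie : 0 < / ep) by now apply Rinv_0_lt_compat.
  apply (power_unbounded ((E - s) / 2) (Rabs D * c0 * c1)); [lra|]. intros n hn.
  assert (hn' : 0 < INR n) by (apply lt_0_INR; lia).
  destruct (exists_small_form n m hn hm) as (a & ha & hav). fold c0 in hav.
  set (B := c0 * sqrt (INR n)) in *.
  assert (hc0 : 0 < c0) by (unfold c0; lra).
  assert (hB : 0 <= B) by (apply Rmult_le_pos; [lra|apply sqrt_pos]).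
  assert (hl2 := form_l2_bound m n (form m n a) (form_multilinear Kcomplex m n a) B hB).
  assert (hl2' : forall x, Cabs (form m n a x) <= B * sqrt (2 * harm n) ^ m * lprod (seq 0 m) (fun j => l2n n (x j))).
  { apply hl2. intros v hv. rewrite form_real, Cabs_real.
    rewrite (lprod_ext _ _ (fun j => rpow (sq_norm n (v j)) (/ 2))) by (intros; now rewrite rpow_sqrt by apply sq_norm_nonneg).
    rewrite <- lprod_rpow, rpow_sqrt by (intros; try apply lprod_nonneg; intros; apply sq_norm_nonneg). auto. }
  set (U := sum_inv m p) in *.
  set (M := B * sqrt (2 * harm n) ^ m * rpow (INR n) (INR m / 2 - U)).
  assert (hk0 : 0 <= sqrt (2 * harm n) ^ m) by (apply pow_le, sqrt_pos).
  destruct (norm_exists K m n p (form m n a) M hp) as (N & hN & hN1).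
  { intros x _ hx. eapply Rle_trans; [apply hl2'|]. unfold M.
    apply Rmult_le_compat_l; [apply Rmult_le_pos; auto|].
    apply Rle_trans with (lprod (seq 0 m) (fun j => rpow (INR n) (/ 2 - ext_inv (p j)))).
    - apply lprod_le; intros j hj%in_seq. split; [apply l2n_nonneg|].
      apply l2n_le_lp; auto; [apply hp; lia|apply hinv; lia|apply hx; lia].
    - rewrite (lprod_rpow_const _ _ (fun j => / 2 - ext_inv (p j))) by auto. apply Req_le. f_equal.
      rewrite (lsum_ext _ _ (fun j => / 2 + (-1) * ext_inv (p j))) by (intros; ring).
      rewrite lsum_plus, lsum_scal, lsum_const, length_seq, <- fsum_lsum. fold (sum_inv m p). fold U. field. }
  assert (h := hD n (form m n a) N hn (form_multilinear K m n a) hN).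
  rewrite (mixed_sum_mx K) in h by (auto; apply form_multilinear).
  rewrite (mx_ext n m r r _ (fun _ => 1)), mx_one, <- fsum_lsum in h; auto.
  2:{ intros l hl. rewrite coef_form by auto. destruct (ha l) as [-> | ->];
        unfold Rabs; destruct Rcase_abs; lra. }
  set (G := fsum m (fun j => / r j)) in *.
  assert (hps := Rpower_pos (INR n) s).
  assert (hD0 := Rabs_pos D).
  assert (h1 : rpow (INR n) G <= Rabs D * rpow (INR n) s * M).
  { rewrite (rpow_Rpower (INR n) s) by auto. eapply Rle_trans; [exact h|].
    apply Rle_trans with (Rabs D * Rpower (INR n) s * N).
    - apply Rmult_le_compat_r; [lra|]. apply Rmult_le_compat_r; [lra|]. apply Rle_abs.
    - apply Rmult_le_compat_l; [|lra]. apply Rmult_le_pos; lra. }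
  assert (h2 : sqrt (2 * harm n) ^ m <= c1 * rpow (INR n) ((E - s) / 2)).
  { assert (hh : 2 * harm n <= 2 * (1 + / ep) * Rpower (INR n) ep).
    { eapply Rle_trans; [|apply log_le_power; auto]. assert (hl := harm_le n hn). lra. }
    apply Rle_trans with ((sqrt (2 * (1 + / ep)) * sqrt (Rpower (INR n) ep)) ^ m).
    - apply pow_incr. split; [apply sqrt_pos|].
      rewrite <- sqrt_mult by (try lra; left; apply Rpower_pos). now apply sqrt_le_1_alt.
    - rewrite Rpow_mult_distr. fold c1. apply Req_le. f_equal.
      rewrite <- rpow_sqrt, <- (rpow_Rpower (INR n)), rpow_rpow by (auto; try lra; left; apply Rpower_pos).
      rewrite rpow_Rpower, <- Rpower_pow, Rpower_mult, <- rpow_Rpower by (auto; apply Rpower_pos).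
      f_equal. unfold ep. field. lra. }
  rewrite <- rpow_Rpower by auto.
  assert (hq := rpow_pos (INR n) (G - (E - s) / 2) hn').
  apply Rmult_le_reg_r with (rpow (INR n) (G - (E - s) / 2)); auto.
  rewrite <- rpow_plus by lra. replace ((E - s) / 2 + (G - (E - s) / 2)) with G by field.
  eapply Rle_trans; [exact h1|]. unfold M, B.
  rewrite <- rpow_sqrt by lra.
  apply Rle_trans with (Rabs D * c0 * (rpow (INR n) s * rpow (INR n) (/ 2) * rpow (INR n) (INR m / 2 - U)) * (c1 * rpow (INR n) ((E - s) / 2))).
  - replace (Rabs D * rpow (INR n) s * (c0 * rpow (INR n) (/ 2) * sqrt (2 * harm n) ^ m * rpow (INR n) (INR m / 2 - U)))
      with (Rabs D * c0 * (rpow (INR n) s * rpow (INR n) (/ 2) * rpow (INR n) (INR m / 2 - U)) * sqrt (2 * harm n) ^ m) by ring.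
    apply Rmult_le_compat_l; auto.
    repeat apply Rmult_le_pos; auto; try apply rpow_nonneg; lra.
  - replace (Rabs D * c0 * (rpow (INR n) s * rpow (INR n) (/ 2) * rpow (INR n) (INR m / 2 - U)) * (c1 * rpow (INR n) ((E - s) / 2)))
      with (Rabs D * c0 * c1 * (rpow (INR n) s * rpow (INR n) (/ 2) * rpow (INR n) (INR m / 2 - U) * rpow (INR n) ((E - s) / 2))) by ring.
    (* The exponents balance: s + 1/2 + (m/2 - U) + (E - s)/2 = G - (E - s)/2. *)
    rewrite <- !rpow_plus by lra. apply Req_le. f_equal. f_equal. unfold E. field.
Qed.
End Optimality.

Theorem mainTheorem4 (K : field_kind) (m : nat) (p : nat -> ext) (r : nat -> R) :
  (2 <= m)%nat ->
  (forall j, (j < m)%nat -> ext_ge1 (p j)) ->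
  sum_inv m p <= 1 / 2 ->
  (forall j, (j < m)%nat -> 1 <= r j <= 2) ->
  let e := Rmax (fsum m (fun j => / r j) - (INR m + 1) / 2 + sum_inv m p) 0 in
  (exists D, 1 <= D /\
     forall (n : nat) (T : (nat -> nat -> Cx) -> Cx) (normT : R),
       (1 <= n)%nat -> is_multilinear K m n T -> is_lub (norm_set K m n p T) normT ->
       mixed_sum m n r T <= D * Rpower (INR n) e * normT) /\
  (forall s, s < e ->
     ~ (exists D, forall (n : nat) (T : (nat -> nat -> Cx) -> Cx) (normT : R),
          (1 <= n)%nat -> is_multilinear K m n T -> is_lub (norm_set K m n p T) normT ->
          mixed_sum m n r T <= D * Rpower (INR n) s * normT)).
Proof.
  intros hm hp hpU hr e. split.
  - exists (2 ^ (m - 1)). split; [apply pow_R1_Rle; lra|].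
    intros n T normT. apply upper_bound; auto; lia.
  - intros s hs (D & hD). apply (Rlt_not_le _ _ hs). apply Rmax_lub.
    + apply (exponent_ge K m p r D s); auto; lia.
    + apply (exponent_nonneg K m p r D s); auto; lia.
Qed.
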